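(* Let $n,d$ be positive integers, let $A=A_n^{dn}$, and let $\mathcal{P}$ be the set of non-crossing partitions of $\underline{n}=\{1,\dots,n\}$. Then: (a) For every $p\in\mathcal{P}$ and every $1\le k\le n$, the sets $\mathcal{L}_{p,k}$ and $\mathcal{S}_{p,k}$ are simple-minded systems of $A$-$\underline{\mathrm{mod}}$. (b) Every simple-minded system of $A$-$\underline{\mathrm{mod}}$ is equal to $\mathcal{L}_{p,k}$ or to $\mathcal{S}_{p,k}$ for some $p\in\mathcal{P}$ and some $1\le k\le n$. (c) If $d\ge 2$, then for all $p,p'\in\mathcal{P}$ and $1\le k,k'\le n$: (1) $\mathcal{L}_{p,k}\neq\mathcal{S}_{p',k'}$; (2) $\mathcal{L}_{p,k}=\mathcal{L}_{p',k'}$ if and only if $p=p'$ and $p(k)=p(k')$; (3) $\mathcal{S}_{p,k}=\mathcal{S}_{p',k'}$ if and only if the following three conditions hold: (i) $p=p'$; (ii) $k=k'$ or $\widehat{k}\cap\widehat{k'}=\emptyset$; (iii) $p_{k\vee k'}$ is a non-crossing partition, where $p_{k\vee k'}$ is the partition whose block containing $i$ is $p(k)\cup p(k')$ if $i\in p(k)\cup p(k')$ and $p(i)$ otherwise.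
   Context: $k$ is an algebraically closed field. For positive integers $n,\ell$, $A_n^\ell=kQ/I$ where $Q$ is the cyclic quiver with vertices $1,\dots,n$ and arrows $i\to i+1$ ($1\le i<n$) and $n\to 1$, and $I$ is the ideal generated by all paths of length $\ell+1$ (a self-injective Nakayama algebra; $A_n^{dn}$ is symmetric). $S_1,\dots,S_n$ are the simple modules. For $a\in\mathbb{Z}$, $\bar a\in\{1,\dots,n\}$ denotes the integer with $a\equiv\bar a\pmod n$. Every indecomposable module is uniserial, with composition factors $S_i,S_{\overline{i+1}},S_{\overline{i+2}},\dots$ from top to socle; it is projective iff its length is $\ell+1$. $M^i_{j,t}$ denotes the indecomposable module with top $S_i$, socle $S_j$, and in which $S_i$ occurs exactly $t+1$ times as a composition factor. $A$-$\underline{\mathrm{mod}}$ is the stable module category, with $\underline{\mathrm{Hom}}_A(M,N)=\mathrm{Hom}_A(M,N)$ modulo maps factoring through projective modules. A simple-minded system (sms) of $A$-$\underline{\mathrm{mod}}$ is a family $\mathcal{S}$ of indecomposable non-projective modules (up to isomorphism) such that $\underline{\mathrm{Hom}}_A(S,T)=0$ for distinct $S,T\in\mathcal{S}$, $\underline{\mathrm{Hom}}_A(S,S)\cong k$ for $S\in\mathcal{S}$, and for every indecomposable non-projective $X$ there is $S\in\mathcal{S}$ with $\underline{\mathrm{Hom}}_A(X,S)\neq0$. A partition $p$ of $\underline{n}$ is non-crossing if there are no $a<x<b<y$ with $a,b$ in one block and $x,y$ in a different block. $p(i)$ denotes the block containing $i$. For $i\in\underline{n}$, let $k_i$ be the first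 element of $p(i)$ in the sequence $\overline{i-1},\overline{i-2},\dots,\overline{i-n}=i$ (so $k_i=i$ if $p(i)=\{i\}$; equivalently $p(i)\subseteq\{i,\overline{i+1},\dots,k_i\}$), and let $\widehat{i}=\{i,\overline{i+1},\overline{i+2},\dots,k_i\}$ (the vertices of the cyclic path from $i$ to $k_i$). For $p\in\mathcal{P}$ and $1\le k\le n$ define $\mathcal{L}_{p,k}=\{M^i_{k_i,l_i}\mid i=1,\dots,n\}$ with $l_i=0$ if $\widehat{i}\cap p(k)=\emptyset$ and $l_i=d-1$ otherwise; $\mathcal{S}_{p,k}=\{M^i_{k_i,l_i}\mid i=1,\dots,n\}$ with $l_i=0$ if $\widehat{i}\cap p(k)=\emptyset$ or $i=k$, and $l_i=d-1$ otherwise. *)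

(* Defs.v *)
From HB Require Import structures.
From mathcomp Require Import all_boot all_order all_algebra.
Set Implicit Arguments. Unset Strict Implicit. Unset Printing Implicit Defensive.
Import GRing.Theory.
Local Open Scope ring_scope.

(* Vertices 1..n of the paper are the ordinals 0..n-1 of 'I_n (shift by one);
   the arrow i -> i+1 (and n -> 1) is  ordS : 'I_n -> 'I_n. *)

(* Row-vector convention: the arrow v -> v+1 acts by  x |-> x *m rmap v. *)
Record rep (k : fieldType) (n : nat) := Rep {
  rdim : 'I_n -> nat;
  rmap : forall v : 'I_n, 'M[k]_(rdim v, rdim (ordS v)) }.

Section Modules.
Variables (k : fieldType) (n : nat).
Implicit Types (M N X Y P : rep k n).

Fixpoint pathm M (v : 'I_n) (m : nat) : 'M[k]_(rdim M v, rdim M (iter m (@ordS n) v)) :=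
  match m return 'M[k]_(rdim M v, rdim M (iter m (@ordS n) v)) with
  | 0 => 1%:M
  | m'.+1 => pathm M v m' *m rmap M (iter m' (@ordS n) v)
  end.

(* M is a module over A_n^l = kQ/I, I generated by all paths of length l+1 *)
Definition is_module (l : nat) M := forall v, pathm M v l.+1 = 0.

Definition hom M N := forall v : 'I_n, 'M[k]_(rdim M v, rdim N v).
Definition is_hom M N (f : hom M N) :=
  forall v, f v *m rmap N v = rmap M v *m f (ordS v).
Definition hcomp M N X (f : hom M N) (g : hom N X) : hom M X := fun v => f v *m g v.
Definition hid M : hom M M := fun v => 1%:M.

Definition iso M N := exists (f : hom M N) (g : hom N M),
  [/\ is_hom f, is_hom g, (forall v, hcomp f g v = hid M v)
    & (forall v, hcomp g f v = hid N v)].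

Definition nonzero M := exists v, (0 < rdim M v)%N.

Definition dsum M N : rep k n :=
  @Rep k n (fun v => (rdim M v + rdim N v)%N)
     (fun v => block_mx (rmap M v) 0 0 (rmap N v)).

Definition indecomposable (l : nat) M :=
  [/\ is_module l M, nonzero M &
   ~ exists M1 M2, [/\ is_module l M1, is_module l M2, nonzero M1, nonzero M2
                     & iso M (dsum M1 M2)]].

Definition projective (l : nat) P :=
  is_module l P /\
  forall X Y (pi : hom X Y) (h : hom P Y),
    is_module l X -> is_module l Y -> is_hom pi -> (forall v, row_full (pi v)) ->
    is_hom h -> exists g : hom P X, is_hom g /\ forall v, g v *m pi v = h v.

Definition factors_proj (l : nat) M N (f : hom M N) :=
  exists P (g : hom M P) (h : hom P N),
    [/\ projective l P, is_hom g, is_hom h & forall v, f v = g v *m h v].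

Definition sHom0 (l : nat) M N := forall f : hom M N, is_hom f -> factors_proj l f.

(* stable End(M) = k, i.e. c |-> class of c*id is a bijection k -> stable End(M) *)
Definition sEnd_k (l : nat) M :=
  (forall c : k, factors_proj l (fun v => c *: hid M v) -> c = 0) /\
  (forall f : hom M M, is_hom f ->
     exists c : k, factors_proj l (fun v => f v - c *: hid M v)).

(* simple-minded systems: a family of modules up to isomorphism, represented
   as an isomorphism-closed class S of modules *)
Definition is_sms (l : nat) (S : rep k n -> Prop) :=
  [/\ (forall X Y, iso X Y -> S X -> S Y),
      (forall X, S X -> indecomposable l X /\ ~ projective l X),
      (forall X Y, S X -> S Y -> ~ iso X Y -> sHom0 l X Y),
      (forall X, S X -> sEnd_k l X)
    & (forall X, indecomposable l X -> ~ projective l X ->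
         exists Y, S Y /\ ~ sHom0 l X Y)].

(* basis e_0,...,e_{L-1}, e_s at vertex i+s, arrows send e_s to e_{s+1};
   L = (j - i mod n) + 1 + t n *)
Definition uni_len (i j : 'I_n) (t : nat) : nat := ((j + n - i) %% n + 1 + t * n)%N.
Definition uni_off (i v : 'I_n) : nat := ((v + n - i) %% n)%N.
Definition uni_dim (i j : 'I_n) (t : nat) (v : 'I_n) : nat :=
  ((uni_len i j t + n - 1 - uni_off i v) %/ n)%N.
Definition Mod (i j : 'I_n) (t : nat) : rep k n :=
  @Rep k n (uni_dim i j t)
    (fun v => \matrix_(a < uni_dim i j t v, b < uni_dim i j t (ordS v))
       (((uni_off i v + a * n).+1 == uni_off i (ordS v) + b * n)%N)%:R).

End Modules.

Section Partitions.
Variable n : nat.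
Implicit Types (P : {set {set 'I_n}}).

Definition noncrossing P :=
  partition P [set: 'I_n] /\
  forall a x b y : 'I_n, (a < x)%N -> (x < b)%N -> (b < y)%N ->
    pblock P a = pblock P b -> pblock P x = pblock P y -> pblock P a = pblock P x.

(* k_i = first element of p(i) in the sequence i-1, i-2, ..., i-n = i;
   kdist P i is the number of backward steps m (1 <= m <= n) *)
Definition kdist P (i : 'I_n) : nat :=
  (find (fun m => iter m.+1 (@ord_pred n) i \in pblock P i) (iota 0 n)).+1.
Definition kvert P (i : 'I_n) : 'I_n := iter (kdist P i) (@ord_pred n) i.
(* hat i = vertices of the cyclic path i, i+1, ..., k_i *)
Definition hat P (i : 'I_n) : {set 'I_n} :=
  [set iter s (@ordS n) i | s : 'I_n & (s <= (n - kdist P i) %% n)%N].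

Definition pjoin P (a b : 'I_n) : {set {set 'I_n}} :=
  ((P :\ pblock P a) :\ pblock P b) :|: [set pblock P a :|: pblock P b].

Definition lL (d : nat) P (kk i : 'I_n) : nat :=
  if [disjoint hat P i & pblock P kk] then 0%N else d.-1.
Definition lS (d : nat) P (kk i : 'I_n) : nat :=
  if [disjoint hat P i & pblock P kk] || (i == kk) then 0%N else d.-1.

Definition famL (k : fieldType) (d : nat) P (kk : 'I_n) (X : rep k n) : Prop :=
  exists i : 'I_n, iso X (Mod k i (kvert P i) (lL d P kk i)).
Definition famS (k : fieldType) (d : nat) P (kk : 'I_n) (X : rep k n) : Prop :=
  exists i : 'I_n, iso X (Mod k i (kvert P i) (lS d P kk i)).

End Partitions.

Arguments famL {n} k d P kk X.
Arguments famS {n} k d P kk X.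

(* Main.v *)
Require Import Defs.
From mathcomp Require Import all_boot all_order all_algebra.
From mathcomp Require Import zify.
Set Implicit Arguments. Unset Strict Implicit. Unset Printing Implicit Defensive.
Import GRing.Theory.

(* A non-zero module has a path of maximal length acting non-trivially on it, and
   the uniserial submodule it generates splits off; so the indecomposable modules
   are the uniserial U i L (top i, length L <= dn+1).  A map from U i L to U j L'
   is the choice of an element of U j L' at i killed by the path of length L, and
   its stable class is given by the coordinates s with s < L' <= s + L <= dn.
   Hence a simple-minded system has exactly one member with top i for each i, say of
   length lam i, and is characterised by the absence of such s between distinct
   members (and of s > 0 for one member); the density condition then follows by a
   pigeonhole argument.

   Write lam i = r i, or lam i = r i + (d-1)n, with 1 <= r i <= n.  The arcs
   {i, ..., i + r i - 1} satisfy the orthogonality condition for d = 1, and the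
   relation "no arc separates x from y" is then a non-crossing partition whose arcs
   are the sets hat i.  Since p(k) never straddles an arc, hat i meets p(k) iff k
   lies in hat i; orthogonality for d >= 2 forces the long arcs to be those through
   a point k, except possibly the arc starting at k. *)

(** * Distances on the cyclic quiver *)

Section CircularDistance.
Variable n : nat.
Implicit Types i j v : 'I_n.

Lemma uni_offE i j : uni_off i j = if i <= j then j - i else j + n - i.
Proof.
rewrite /uni_off; have := ltn_ord i; have := ltn_ord j => hj hi.
case: leqP => h; last by rewrite modn_small //; lia.
by rewrite addnC -addnBA // modnDl modn_small //; lia.
Qed.

Lemma uni_off_lt i j : uni_off i j < n.
Proof. by rewrite ltn_mod; case: n i => [[]|]. Qed.

Lemma uni_offii i : uni_off i i = 0.
Proof. by rewrite uni_offE leqnn subnn. Qed.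

Lemma val_iter_ordS s i : iter s (@ordS n) i = (i + s) %% n :> nat.
Proof.
elim: s => [|s IHs] /=; first by rewrite addn0 modn_small.
by rewrite IHs -addn1 modnDml addn1 addnS.
Qed.

Lemma modn_uni_off i v m : (i + (uni_off i v + m)) %% n = (v + m) %% n.
Proof.
rewrite addnA -modnDml /uni_off modnDmr subnKC; last first.
  by have := ltn_ord i; lia.
by rewrite modnDr modnDml.
Qed.

Lemma iter_off i v a : iter (uni_off i v + a * n) (@ordS n) i = v.
Proof.
by apply: ord_inj; rewrite val_iter_ordS modn_uni_off addnC modnMDl modn_small.
Qed.

Lemma iter_ordSP s i v :
  reflect (iter s (@ordS n) i = v) (s %% n == uni_off i v).
Proof.
apply: (iffP eqP) => [h|<-].
  by rewrite (divn_eq s n) h addnC iter_off.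
rewrite /uni_off val_iter_ordS; have := ltn_ord i => hi.
rewrite -addnBA ?modnDml; last lia.
by rewrite (_ : i + s + (n - i) = s + n) ?modnDr //; lia.
Qed.

Lemma iter_ordS_eq s i v :
  iter s (@ordS n) i = v -> s = uni_off i v + (s %/ n) * n.
Proof. by move/iter_ordSP/eqP=> <-; rewrite addnC -divn_eq. Qed.

End CircularDistance.

(** * Representations and homomorphisms *)

Section Representations.
Local Open Scope ring_scope.
Variables (k : fieldType) (n : nat).
Local Notation hom := Defs.hom.
Implicit Types (M N X Y P : rep k n) (i j u v w : 'I_n).

(** The end vertex of [pathm] is the term [iter s (@ordS n) u]; transport along a proof [e] lets
    paths be composed whose ends agree only propositionally. *)
Definition pth M u s v (e : iter s (@ordS n) u = v) : 'M[k]_(rdim M u, rdim M v) :=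
  eq_rect _ (fun w => 'M[k]_(rdim M u, rdim M w)) (pathm M u s) v e.

Lemma pth_irr M u s s' v (e : iter s (@ordS n) u = v) (e' : iter s' (@ordS n) u = v) :
  s = s' -> pth M e = pth M e'.
Proof. by move=> es; case: s' / es e' => e'; rewrite (eq_irrelevance e e'). Qed.

Lemma pth0 M u (e : iter 0 (@ordS n) u = u) : pth M e = 1%:M.
Proof. by rewrite (eq_irrelevance e erefl). Qed.

Lemma pthSr M u s v (e : iter s (@ordS n) u = v) (e' : iter s.+1 (@ordS n) u = ordS v) :
  pth M e *m rmap M v = pth M e'.
Proof. by case: v / e e' => e'; rewrite (eq_irrelevance e' erefl). Qed.

Lemma pthSl M u s v (e : iter s (@ordS n) (ordS u) = v) (e' : iter s.+1 (@ordS n) u = v) :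
  rmap M u *m pth M e = pth M e'.
Proof.
elim: s v e e' => [|s IHs] v e e'.
  by case: v / e e' => e'; rewrite pth0 mulmx1 (eq_irrelevance e' erefl) /pth /= mul1mx.
have e1 : ordS (iter s (@ordS n) (ordS u)) = v := e.
have e2 : iter s.+1 (@ordS n) u = iter s (@ordS n) (ordS u) by rewrite iterSr.
case: v / e1 e e' => e e'.
by rewrite -(pthSr M (erefl _) e) mulmxA (IHs _ _ e2) (pthSr M e2 e').
Qed.

Lemma hom_pth M N (f : hom M N) (hf : is_hom f) u s v (e : iter s (@ordS n) u = v) :
  f u *m pth N e = pth M e *m f v.
Proof.
elim: s v e => [|s IHs] v e; first by case: v / e; rewrite !pth0 mulmx1 mul1mx.
have e1 : ordS (iter s (@ordS n) u) = v := e; case: v / e1 e => e.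
by rewrite -!(pthSr _ (erefl _) e) mulmxA IHs -mulmxA hf mulmxA.
Qed.

Lemma pth_eq0 M u s v (e : iter s (@ordS n) u = v) : pathm M u s = 0 -> pth M e = 0.
Proof. by case: v / e. Qed.

Lemma is_hom_comp M N X (f : hom M N) (g : hom N X) :
  is_hom f -> is_hom g -> is_hom (hcomp f g).
Proof. by move=> hf hg v; rewrite /hcomp -mulmxA hg mulmxA hf mulmxA. Qed.

Lemma is_hom_id M : is_hom (hid M).
Proof. by move=> v; rewrite /hid mulmx1 mul1mx. Qed.

Lemma is_homB M N (f g : hom M N) (a : k) : is_hom f -> is_hom g ->
  is_hom (fun v => f v - a *: g v).
Proof.
by move=> hf hg v; rewrite mulmxBl mulmxBr hf -scalemxAl -scalemxAr hg.
Qed.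

Lemma is_hom_inv M N (f : hom M N) (g : hom N M) : is_hom f ->
  (forall v, f v *m g v = 1%:M) -> (forall v, g v *m f v = 1%:M) -> is_hom g.
Proof.
move=> hf fg gf v.
by rewrite -[rmap M v]mulmx1 -fg !mulmxA -(mulmxA (g v)) -hf mulmxA gf mul1mx.
Qed.

Lemma iso_of_inverse M N (f : hom M N) (g : hom N M) : is_hom f ->
  (forall v, f v *m g v = 1%:M) -> (forall v, g v *m f v = 1%:M) -> iso M N.
Proof. by move=> hf fg gf; exists f, g; split=> //; apply: is_hom_inv hf _ _. Qed.

Lemma iso_refl M : iso M M.
Proof. by apply: (@iso_of_inverse M M (hid M) (hid M) (@is_hom_id M)) => v; rewrite mulmx1. Qed.

Lemma iso_sym M N : iso M N -> iso N M.
Proof. by case=> f [g [hf hg fg gf]]; exists g, f. Qed.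

Lemma iso_trans M N X : iso M N -> iso N X -> iso M X.
Proof.
case=> f [g [hf hg fg gf]] [f' [g' [hf' hg' fg' gf']]].
apply: (@iso_of_inverse _ _ (hcomp f f') (hcomp g' g)); first exact: is_hom_comp.
  by move=> v; rewrite /hcomp mulmxA -(mulmxA (f v)) [f' v *m _]fg' mulmx1 [LHS]fg.
by move=> v; rewrite /hcomp mulmxA -(mulmxA (g' v)) [g v *m _]gf mulmx1 [LHS]gf'.
Qed.

Lemma iso_path_eq0 M N u s : iso M N -> pathm M u s = 0 -> pathm N u s = 0.
Proof.
case=> f [g [hf hg fg gf]] h.
have := hom_pth hf (erefl (iter s (@ordS n) u)); rewrite /pth /= h mul0mx.
by move/(congr1 (mulmx (g u))); rewrite mulmxA [g u *m _]gf mul1mx mulmx0.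
Qed.

Lemma iso_is_module l M N : iso M N -> is_module l M -> is_module l N.
Proof. by move=> MN hM v; apply: iso_path_eq0 MN (hM v). Qed.

Lemma iso_nonzero M N : iso M N -> nonzero M -> nonzero N.
Proof.
case=> f [g [hf hg fg gf]] [v hv]; exists v.
rewrite lt0n; apply/eqP => N0.
have := fg v; rewrite /hcomp /hid.
have -> : f v = 0 by apply/matrixP => a b; have := ltn_ord b; rewrite {2}N0.
rewrite mul0mx => /matrixP/(_ (Ordinal hv) (Ordinal hv)); rewrite !mxE eqxx.
by move/eqP; rewrite eq_sym oner_eq0.
Qed.

Lemma iso_indecomposable l M N : iso M N -> indecomposable l M -> indecomposable l N.
Proof.
move=> MN [hm hn0 hM]; split; first exact: iso_is_module hm.
  exact: iso_nonzero hn0.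
case=> M1 [M2 [h1 h2 h3 h4 h5]]; apply: hM; exists M1, M2; split=> //.
exact: iso_trans h5.
Qed.

Lemma factors_proj_comp l M M' N N' (f : hom M N) (g : hom M' M) (h : hom N N') :
  is_hom g -> is_hom h -> factors_proj l f ->
  factors_proj l (fun v => g v *m f v *m h v).
Proof.
move=> hg hh [P [a [b [hP ha hb ab]]]]; exists P, (hcomp g a), (hcomp b h).
split; rewrite // ?/hcomp; try exact: is_hom_comp.
by move=> v; rewrite ab !mulmxA.
Qed.

Lemma factors_proj_ext l M N (f g : hom M N) : (forall v, f v = g v) ->
  factors_proj l f -> factors_proj l g.
Proof.
by move=> fg [P [a [b [hP ha hb ab]]]]; exists P, a, b; split=> // v; rewrite -fg.
Qed.

Lemma iso_projective l M N : iso M N -> projective l M -> projective l N.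
Proof.
move=> MN [hm hM]; split; first exact: iso_is_module hm.
case: MN => f [g [hf hg fg gf]] X Y p h hX hY hp sp hh.
have [q [hq qp]] := hM X Y p (hcomp f h) hX hY hp sp (is_hom_comp hf hh).
exists (hcomp g q); split; first exact: is_hom_comp.
by move=> v; rewrite /hcomp -mulmxA qp /hcomp mulmxA [g v *m _]gf mul1mx.
Qed.

Lemma iso_sHom0 l M M' N N' : iso M M' -> iso N N' -> sHom0 l M N -> sHom0 l M' N'.
Proof.
case=> f [g [hf hg fg gf]] [f' [g' [hf' hg' fg' gf']]] h a ha.
have := h (hcomp (hcomp f a) g') (is_hom_comp (is_hom_comp hf ha) hg').
move/(factors_proj_comp hg hf'); apply: factors_proj_ext => v.
rewrite /hcomp !mulmxA [g v *m _]gf mul1mx -mulmxA [g' v *m _]gf' mulmx1 //.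
Qed.

Lemma iso_sEnd_k l M N : iso M N -> sEnd_k l M -> sEnd_k l N.
Proof.
case=> f [g [hf hg fg gf]] [h1 h2]; split.
  move=> c /(factors_proj_comp hf hg) hc; apply: h1; apply: factors_proj_ext hc => v.
  by rewrite /hid -scalemxAr -scalemxAl mulmx1 [_ *m _]fg.
move=> a ha; have [c hc] := h2 _ (is_hom_comp (is_hom_comp hf ha) hg).
exists c; have := factors_proj_comp hg hf hc; apply: factors_proj_ext => v.
rewrite mulmxBr mulmxBl /hcomp !mulmxA [g v *m _]gf mul1mx -mulmxA [g v *m _]gf mulmx1.
by rewrite /hid -scalemxAr -scalemxAl mulmx1 [_ *m _]gf.
Qed.

End Representations.

(** * Uniserial modules *)

Section Uniserial.
Local Open Scope ring_scope.
Variables (k : fieldType) (n : nat).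
Local Notation hom := Defs.hom.
Implicit Types (M N X Y P : rep k n) (i j u v w : 'I_n).

(** The formula of [uni_dim] with the length as a parameter, so that [Mod] is convertible to a
    uniserial module and lengths can vary freely. *)
Definition udim i (L : nat) v : nat := ((L + n - 1 - uni_off i v) %/ n)%N.

Definition uniserial i (L : nat) : rep k n :=
  @Rep k n (udim i L)
    (fun v => \matrix_(a < udim i L v, b < udim i L (ordS v))
       (((uni_off i v + a * n).+1 == uni_off i (ordS v) + b * n)%N)%:R).
Local Notation U := uniserial.

Lemma Mod_uniserial i j t : Mod k i j t = U i (uni_len i j t).
Proof. by []. Qed.

Lemma ltn_udim i L v a : (a < udim i L v)%N = (uni_off i v + a * n < L)%N.
Proof.
have h := uni_off_lt i v; rewrite /udim leq_divRL; last lia.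
by rewrite mulSn; lia.
Qed.

(** The basis vector e_s, totalised: the row is zero unless e_s sits at [v] and s < L, so no index
    bounds have to be carried along. *)
Definition bvec i (L s : nat) v : 'rV[k]_(udim i L v) :=
  \row_b ((s == uni_off i v + b * n)%N)%:R.

Lemma bvec_eq0 i L s v : (L <= s)%N -> bvec i L s v = 0.
Proof.
move=> h; apply/rowP => b; rewrite !mxE; have := ltn_ord b; rewrite ltn_udim.
by case: eqP => //; lia.
Qed.

Lemma delta_bvec i L v (a : 'I_(udim i L v)) : delta_mx 0 a = bvec i L (uni_off i v + a * n) v.
Proof.
apply/rowP => b; rewrite !mxE eqxx /= eqn_add2l eqn_pmul2r; last by have := ltn_ord i; lia.
by rewrite eq_sym.
Qed.

Lemma row_bvec i L v m (A : 'M[k]_(udim i L v, m)) (a : 'I_(udim i L v)) :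
  row a A = bvec i L (uni_off i v + a * n) v *m A.
Proof. by rewrite rowE delta_bvec. Qed.

Lemma udim_index i L s v : iter s (@ordS n) i = v -> (s < L)%N ->
  exists a : 'I_(udim i L v), s = (uni_off i v + a * n)%N.
Proof.
move/iter_ordS_eq => es h; have ha : (s %/ n < udim i L v)%N by rewrite ltn_udim -es.
by exists (Ordinal ha).
Qed.

Lemma bvec_rmap i L s v : iter s (@ordS n) i = v ->
  bvec i L s v *m rmap (U i L) v = bvec i L s.+1 (ordS v).
Proof.
move=> e; case: (ltnP s L) => h; last by rewrite !bvec_eq0 ?mul0mx //; lia.
have [a ->] := udim_index e h.
by rewrite -row_bvec; apply/rowP => b; rewrite !mxE.
Qed.

Lemma rmap_bvec i L s v : iter s (@ordS n) i = v -> (s.+1 < L)%N ->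
  rmap (U i L) v *m (bvec i L s.+1 (ordS v))^T = (bvec i L s v)^T.
Proof.
move=> e h.
have e' : iter s.+1 (@ordS n) i = ordS v by rewrite iterS e.
have [b eb] := udim_index e' h.
rewrite [in LHS]eb -delta_bvec trmx_delta -colE.
by apply/colP => a; rewrite !mxE -eb eqSS eq_sym.
Qed.

Lemma bvec_pth i L s v m w (e : iter m (@ordS n) v = w) : iter s (@ordS n) i = v ->
  bvec i L s v *m pth (U i L) e = bvec i L (s + m) w.
Proof.
move=> es; elim: m w e => [|m IHm] w e.
  by case: w / e; rewrite addn0 pth0 mulmx1.
have e1 : ordS (iter m (@ordS n) v) = w := e; case: w / e1 e => e.
rewrite -(pthSr _ (erefl _) e) mulmxA IHm bvec_rmap ?addnS //.
by rewrite addnC iterD es.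
Qed.

Lemma pth_bvec i L s v m w (e : iter m (@ordS n) v = w) : iter s (@ordS n) i = v ->
  (s + m < L)%N -> pth (U i L) e *m (bvec i L (s + m) w)^T = (bvec i L s v)^T.
Proof.
move=> es; elim: m w e => [|m IHm] w e h.
  by case: w / e; rewrite addn0 pth0 mul1mx.
have e1 : ordS (iter m (@ordS n) v) = w := e; case: w / e1 e => e.
rewrite -(pthSr _ (erefl _) e) -mulmxA addnS rmap_bvec ?IHm //; try lia.
by rewrite addnC iterD es.
Qed.

Lemma uniserial_row i L v (a : 'I_(udim i L v)) m (A : 'M[k]_(udim i L v, m)) :
  row a A = bvec i L 0 i *m pth (U i L) (iter_off i v a) *m A.
Proof. by rewrite (bvec_pth _ (iter_off i v a)) // row_bvec. Qed.

Lemma pathm_uniserial_eq0 i L v m :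
  (pathm (U i L) v m = 0) <-> (L <= uni_off i v + m)%N.
Proof.
have ev : iter (uni_off i v) (@ordS n) i = v.
  by have := iter_off i v 0; rewrite mul0n addn0.
split=> [h|h].
  rewrite leqNgt; apply/negP => hL.
  have := pth_bvec (erefl (iter m (@ordS n) v)) ev hL.
  rewrite /pth /= h mul0mx.
  have [a ea] := udim_index ev (leq_ltn_trans (leq_addr _ _) hL).
  move=> /matrixP/(_ a 0); rewrite !mxE -ea eqxx => /eqP.
  by rewrite eq_sym oner_eq0.
apply/row_matrixP => a; rewrite row0 row_bvec.
rewrite (bvec_pth _ (erefl (iter m (@ordS n) v)) (iter_off i v a)).
by rewrite bvec_eq0 //; lia.
Qed.

Lemma uniserial_module l i L : (L <= l.+1)%N -> is_module l (U i L).
Proof. by move=> h v; apply/pathm_uniserial_eq0; lia. Qed.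

Lemma iso_uniserial_inj i j L L' : (0 < L)%N -> (0 < L')%N ->
  iso (U i L) (U j L') -> i = j /\ L = L'.
Proof.
move=> h h' e.
have lt v m : (uni_off i v + m < L)%N = (uni_off j v + m < L')%N.
  rewrite !ltnNge; congr (~~ _); apply/idP/idP => /pathm_uniserial_eq0 hv;
    apply/pathm_uniserial_eq0.
    exact: iso_path_eq0 hv.
  exact: iso_path_eq0 (iso_sym e) hv.
(* The longest non-zero paths out of the two tops bound L and L' by each other and force the offsets
   to vanish. *)
have := lt i L.-1; have := lt j L'.-1; rewrite !uni_offii.
have [h1 h2] : (L.-1 < L)%N /\ (L'.-1 < L')%N by lia.
rewrite !add0n h1 h2 => h3 h4.
have h5 : uni_off i j = 0%N by lia.
split; last by lia.
by have := iter_off i j 0; rewrite h5.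
Qed.

(** * Homomorphisms out of a uniserial module and projective covers *)

Definition ext X i (L : nat) (x : 'rV[k]_(rdim X i)) : Defs.hom (U i L) X :=
  fun v => \matrix_(a < udim i L v) (x *m pth X (iter_off i v a)).

Lemma ext_bvec X i L (x : 'rV[k]_(rdim X i)) s v (e : iter s (@ordS n) i = v) :
  (s < L)%N -> bvec i L s v *m ext L x v = x *m pth X e.
Proof.
move=> h; have [a ea] := udim_index e h.
by rewrite [in LHS]ea -row_bvec rowK; congr (_ *m _); apply: pth_irr.
Qed.

Lemma ext_bvec0 X i L (x : 'rV[k]_(rdim X i)) : (0 < L)%N ->
  bvec i L 0 i *m ext L x i = x.
Proof. by move=> h; rewrite (ext_bvec _ (erefl _ : iter 0 _ i = i)) // pth0 mulmx1. Qed.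

(** [ext L x] sends e_s to x times the path of length s; the only relation to respect is that e_0 is
    killed by the path of length L. *)
Lemma is_hom_ext X i L (x : 'rV[k]_(rdim X i)) :
  x *m pathm X i L = 0 -> is_hom (ext L x).
Proof.
move=> hx v; apply/row_matrixP => a.
rewrite !row_bvec !mulmxA bvec_rmap ?iter_off // (ext_bvec _ (iter_off i v a)); last first.
  by rewrite -ltn_udim.
have e : iter (uni_off i v + a * n).+1 (@ordS n) i = ordS v by rewrite iterS iter_off.
rewrite -mulmxA (pthSr _ _ e).
case: (ltnP (uni_off i v + a * n).+1 L) => h; first by rewrite (ext_bvec _ e).
rewrite bvec_eq0 // mul0mx; have hL : (uni_off i v + a * n).+1 = L.
  by have := ltn_ord a; rewrite ltn_udim; lia.
by move: e; rewrite hL => e; case: _ / e.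
Qed.

Lemma hom_uniserial_ext X i L (f g : hom (U i L) X) : is_hom f -> is_hom g ->
  bvec i L 0 i *m f i = bvec i L 0 i *m g i -> forall v, f v = g v.
Proof.
move=> hf hg fg v; apply/row_matrixP => a.
by rewrite !uniserial_row -!mulmxA -(hom_pth hf) -(hom_pth hg) !mulmxA fg.
Qed.

Lemma hom_pathm_eq0 X i L (f : hom (U i L) X) : is_hom f ->
  bvec i L 0 i *m f i *m pathm X i L = 0.
Proof.
move=> hf; have := hom_pth hf (erefl (iter L (@ordS n) i)); rewrite /pth /= -mulmxA => ->.
have /pathm_uniserial_eq0 -> : (L <= uni_off i i + L)%N by rewrite leq_addl.
by rewrite mul0mx mulmx0.
Qed.

(** The generator e_0 may go to any element at [j], since paths of length l+1 vanish on every
    module; hence a map lifts as soon as the image of e_0 does. *)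
Lemma uniserial_projective l j : projective l (U j l.+1).
Proof.
split; first exact: uniserial_module.
move=> X Y p h hX hY hp sp hh.
pose x := bvec j l.+1 0 j *m h j *m pinvmx (p j).
have xp : x *m p j = bvec j l.+1 0 j *m h j by rewrite mulmxKpV // submx_full.
have hx : is_hom (ext l.+1 x) by apply: is_hom_ext; rewrite hX mulmx0.
exists (ext l.+1 x); split=> // v.
rewrite -[LHS]/(hcomp _ _ _); apply: hom_uniserial_ext => //; first exact: is_hom_comp.
by rewrite /hcomp mulmxA ext_bvec0.
Qed.

Definition cover l j L : hom (U j l.+1) (U j L) := @ext (U j L) j l.+1 (bvec j L 0 j).

Lemma cover_bvec l j L s v : (L <= l.+1)%N -> iter s (@ordS n) j = v ->
  bvec j l.+1 s v *m cover l j L v = bvec j L s v.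
Proof.
move=> hL e; case: (ltnP s l.+1) => h; last by rewrite !bvec_eq0 ?mul0mx //; lia.
by rewrite (ext_bvec _ e) // (bvec_pth _ e).
Qed.

Lemma is_hom_cover l j L : (L <= l.+1)%N -> is_hom (cover l j L).
Proof.
move=> hL; apply: is_hom_ext.
have /pathm_uniserial_eq0 -> : (L <= uni_off j j + l.+1)%N by lia.
by rewrite mulmx0.
Qed.

Lemma cover_full l j L v : (L <= l.+1)%N -> row_full (cover l j L v).
Proof.
move=> hL; apply/row_fullP.
exists (\matrix_(a < udim j L v) bvec j l.+1 (uni_off j v + a * n) v).
apply/row_matrixP => a; rewrite row_mul rowK cover_bvec ?iter_off //.
by rewrite row1 delta_bvec.
Qed.

(** * Coordinates and stable homomorphisms between uniserial modules *)

Definition coef i (L s : nat) v (y : 'rV[k]_(udim i L v)) : k := (y *m (bvec i L s v)^T) 0 0.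

Lemma coef_bvec i L s t v : iter s (@ordS n) i = v -> (s < L)%N ->
  coef s (bvec i L t v) = (t == s)%:R.
Proof.
move=> e h; have [a ->] := udim_index e h.
rewrite /coef -delta_bvec trmx_delta -colE !mxE.
by [].
Qed.

Lemma row_coef i L v (y : 'rV[k]_(udim i L v)) :
  y = \sum_(a < udim i L v) coef (uni_off i v + a * n) y *: bvec i L (uni_off i v + a * n) v.
Proof.
rewrite {1}[y]row_sum_delta; apply: eq_bigr => a _.
by rewrite /coef -delta_bvec trmx_delta -colE mxE.
Qed.

Lemma coef_pth i L s v m w (e : iter m (@ordS n) v = w) (y : 'rV[k]_(udim i L v)) :
  iter s (@ordS n) i = v -> (s + m < L)%N -> coef (s + m) (y *m pth (U i L) e) = coef s y.
Proof. by move=> es h; rewrite /coef -mulmxA pth_bvec. Qed.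

Lemma coef_cover l j L s v (y : 'rV[k]_(udim j l.+1 v)) : (L <= l.+1)%N ->
  iter s (@ordS n) j = v -> (s < L)%N -> coef s (y *m cover l j L v) = coef s y.
Proof.
move=> hL e h; rewrite {1}[y]row_coef [in RHS](row_coef y) /coef !mulmx_suml.
rewrite !summxE; apply: eq_bigr => a _.
rewrite -!scalemxAl cover_bvec ?iter_off // [LHS]mxE [RHS]mxE; congr (_ * _).
by rewrite [LHS](coef_bvec _ e) // [RHS](coef_bvec _ e) //; lia.
Qed.

(** A map into [U j L'] that factors through a projective factors through the cover [U j l.+1].
    There the lift of the image of e_0 must be killed by the path of length L, that is, its
    coordinates s with s + L <= l vanish. *)
Lemma factors_projP l i L j L' (f : hom (U i L) (U j L')) : (0 < L)%N -> (L' <= l.+1)%N ->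
  is_hom f ->
  factors_proj l f <->
  (forall s, iter s (@ordS n) j = i -> (s < L')%N -> (s + L <= l)%N ->
     coef s (bvec i L 0 i *m f i) = 0).
Proof.
move=> hL hL' hf; split.
  case=> P [g [h [hP hg hh fgh]]] s e sL sl.
  have [h' [hh' h'p]] := hP.2 _ _ (cover l j L') h (uniserial_module j (leqnn _))
    (uniserial_module j hL') (is_hom_cover j hL') (fun v => cover_full j v hL') hh.
  rewrite fgh -h'p !mulmxA coef_cover //.
  have := hom_pathm_eq0 (is_hom_comp hg hh'); rewrite /hcomp mulmxA => z.
  by rewrite -(coef_pth (erefl (iter L (@ordS n) i)) _ e) // /pth /= z /coef mul0mx mxE.
move=> hc; set x := bvec i L 0 i *m f i in hc.
(* The candidate lift keeps the coordinates of [x] and is zero in the new positions from L' on. *)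
pose y := \sum_(a < udim j L' i)
  coef (uni_off j i + a * n) x *: bvec j l.+1 (uni_off j i + a * n) i.
have hy : y *m pathm (U j l.+1) i L = 0.
  rewrite mulmx_suml big1 // => a _; rewrite -scalemxAl.
  rewrite [_ *m _](bvec_pth _ (erefl _) (iter_off j i a)).
  case: (leqP (uni_off j i + a * n + L) l) => h; last by rewrite bvec_eq0 ?scaler0.
  by rewrite hc ?scale0r ?iter_off // -ltn_udim.
exists (U j l.+1), (@ext (U j l.+1) i L y), (cover l j L'); split.
- exact: uniserial_projective.
- exact: is_hom_ext.
- exact: is_hom_cover.
rewrite -[forall v, _]/(forall v, f v = hcomp (@ext (U j l.+1) i L y) (cover l j L') v).
apply: hom_uniserial_ext => //.
  by apply: is_hom_comp; [exact: is_hom_ext | exact: is_hom_cover].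
rewrite /hcomp mulmxA ext_bvec0 // -/x [LHS]row_coef mulmx_suml; apply: eq_bigr => a _.
by rewrite -scalemxAl cover_bvec // iter_off.
Qed.

(** These positions index a basis of the stable Hom space: the third condition makes sending e_0 to
    e_s a homomorphism, the fourth prevents it from factoring through a projective. *)
Definition stable_pos l i L j L' (s : nat) :=
  [/\ iter s (@ordS n) j = i, (s < L')%N, (L' <= s + L)%N & (s + L <= l)%N].

Lemma coef_hom_eq0 i L j L' (f : hom (U i L) (U j L')) s : is_hom f ->
  iter s (@ordS n) j = i -> (s + L < L')%N -> coef s (bvec i L 0 i *m f i) = 0.
Proof.
move=> hf e h; have z := hom_pathm_eq0 hf.
by rewrite -(coef_pth (erefl (iter L (@ordS n) i)) _ e) // /pth /= z /coef mul0mx mxE.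
Qed.

Lemma stable_pos_hom l i L j L' s : (0 < L)%N -> stable_pos l i L j L' s ->
  exists f : hom (U i L) (U j L'),
    is_hom f /\ bvec i L 0 i *m f i = bvec j L' s i.
Proof.
move=> hL [e h1 h2 h3]; exists (@ext (U j L') i L (bvec j L' s i)); split; last exact: ext_bvec0.
apply: is_hom_ext; rewrite [_ *m _](bvec_pth _ (erefl _) e) bvec_eq0 //.
Qed.

Lemma sHom0_uniserial l i L j L' : (0 < L)%N -> (L' <= l.+1)%N ->
  sHom0 l (U i L) (U j L') <-> forall s, ~ stable_pos l i L j L' s.
Proof.
move=> hL hL'; split=> [h s hs|h f hf].
  have [f [hf ef]] := stable_pos_hom hL hs; have [e h1 h2 h3] := hs.
  have /(factors_projP hL hL' hf)/(_ s e h1 h3) := h f hf.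
  by rewrite ef coef_bvec // eqxx => /eqP; rewrite oner_eq0.
apply/factors_projP => // s e h1 h3; case: (ltnP (s + L) L') => h2.
  exact: coef_hom_eq0.
by case: (h s).
Qed.

(** Position 0 is the identity and is always present, so the stable endomorphisms are the scalars
    exactly when no other position occurs. *)
Lemma sEnd_k_uniserial l i L : (0 < L <= l)%N ->
  sEnd_k l (U i L) <-> forall s, stable_pos l i L i L s -> s = 0%N.
Proof.
move=> /andP[hL hl]; have hl1 : (L <= l.+1)%N by lia.
have hid0 c : is_hom (fun v => c *: hid (U i L) v).
  by move=> v; rewrite -scalemxAl -scalemxAr mul1mx mulmx1.
have chid c s : iter s (@ordS n) i = i -> (s < L)%N ->
    coef s (bvec i L 0 i *m (c *: hid (U i L) i)) = c * (0 == s)%:R.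
  by move=> e h; rewrite /coef -scalemxAr mulmx1 -scalemxAl mxE -/(coef _ _) coef_bvec.
have cB s (x y : 'rV[k]_(udim i L i)) : coef s (x - y) = coef s x - coef s y.
  by rewrite /coef mulmxBl !mxE.
split=> [[h1 h2] s hs|h].
  have [f [hf ef]] := stable_pos_hom hL hs; have [e s1 s2 s3] := hs.
  case: (posnP s) => // s0; have [c] := h2 f hf.
  move/(factors_projP hL hl1 (is_homB c hf (@is_hom_id _ _ _))) => hc.
  have := hc 0%N erefl hL hl; have := hc s e s1 s3.
  rewrite mulmxBr ef !cB !chid // !coef_bvec // eqxx (negbTE (lt0n_neq0 s0)).
  rewrite eq_sym (negbTE (lt0n_neq0 s0)) mulr0 subr0 => /eqP.
  by rewrite oner_eq0.
split=> [c /(factors_projP hL hl1 (hid0 c))/(_ 0%N erefl hL hl)|f hf].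
  by rewrite chid // mulr1.
exists (coef 0 (bvec i L 0 i *m f i)).
apply/(factors_projP hL hl1 (is_homB _ hf (@is_hom_id _ _ _))) => s e s1 s3.
rewrite mulmxBr cB chid //; have -> : s = 0%N by apply: h; split=> //; lia.
by rewrite eqxx mulr1 subrr.
Qed.

Lemma uniserial_not_projective l i L : (0 < L <= l)%N -> ~ projective l (U i L).
Proof.
move=> /andP[hL hl] hP; have hl1 : (L <= l.+1)%N by lia.
have : factors_proj l (hid (U i L)).
  by exists (U i L), (hid _), (hid _); split=> // [||v]; [exact: is_hom_id.. | rewrite mulmx1].
move/(factors_projP hL hl1 (@is_hom_id _ _ _))/(_ 0%N erefl hL hl).
by rewrite mulmx1 coef_bvec // => /eqP; rewrite oner_eq0.
Qed.

Lemma uniserial_nonzero i L : (0 < L)%N -> nonzero (U i L).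
Proof. by move=> h; exists i; rewrite /= ltn_udim uni_offii. Qed.

End Uniserial.

(** * Classification of the indecomposable modules *)

Section Classification.
Local Open Scope ring_scope.
Variables (k : fieldType) (n : nat).
Local Notation hom := Defs.hom.
Local Notation U := (@uniserial k n).
Implicit Types (M N X Y P : rep k n) (i j u v w : 'I_n).

(* In the basis [bvec s] an endomorphism of a uniserial module is upper triangular
   with constant diagonal. *)
Lemma endo_uniserial_unit i L (f : hom (U i L) (U i L)) : is_hom f ->
  coef 0 (bvec k i L 0 i *m f i) != 0 -> forall v, f v \in unitmx.
Proof.
move=> hf hc v; set x := _ *m _ in hc.
have entry a b : f v a b = coef (uni_off i v + b * n) (x *m pth (U i L) (iter_off i v a)).
  rewrite /x -mulmxA (hom_pth hf) mulmxA -uniserial_row /coef -delta_bvec.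
  by rewrite trmx_delta -colE !mxE.
rewrite unitmxE -det_tr det_trig.
  rewrite unitfE; apply/prodf_neq0 => a _; rewrite mxE entry.
  have := coef_pth (s := 0) (L := L) (iter_off i v a) x erefl.
  by rewrite add0n -ltn_udim => ->.
apply/is_trig_mxP => b a ba; rewrite mxE entry (row_coef x) mulmx_suml /coef mulmx_suml.
rewrite summxE big1 // => c _; rewrite -!scalemxAl.
rewrite (bvec_pth _ _ (iter_off i v a) (iter_off i i c)) mxE.
rewrite [X in _ * X](coef_bvec _ _ (iter_off i v b)) -?ltn_udim //.
case: eqP => [e|]; rewrite ?mulr0 //.
have : (b * n < a * n)%N by rewrite ltn_pmul2r //; have := ltn_ord i; lia.
by move: e; lia.
Qed.

Lemma is_hom_dsum_proj M N (b c : bool) :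
  is_hom (fun v => block_mx b%:R%:M 0 0 c%:R%:M : 'M_(rdim (dsum M N) v, rdim (dsum M N) v)).
Proof.
move=> v; rewrite /= !mulmx_block !mul0mx !mulmx0 !addr0 !add0r.
by rewrite !scalar_mxC.
Qed.

Lemma idempotent_unit m (e : 'M[k]_m) : e *m e = e -> e \in unitmx -> e = 1%:M.
Proof. by move=> ee eu; rewrite -[e]mul1mx -(mulVmx eu) -mulmxA ee. Qed.

(** A decomposition gives two complementary idempotents, and the coefficients of e_0 in the two
    images of e_0 add up to 1. One of them is non-zero, so that idempotent is invertible, hence the
    identity, and the other summand is zero. *)
Lemma uniserial_indecomposable l i L : (0 < L <= l.+1)%N -> indecomposable l (U i L).
Proof.
move=> /andP[hL hl]; split; [exact: uniserial_module | exact: uniserial_nonzero |].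
case=> M1 [M2 [_ _ [v1 h1] [v2 h2] [F [G [hF hG FG GF]]]]].
pose D (b : bool) v : 'M[k]_(rdim (dsum M1 M2) v) := block_mx b%:R%:M 0 0 (~~ b)%:R%:M.
have hD b : is_hom (D b) by apply: is_hom_dsum_proj.
pose e b := hcomp (hcomp F (D b)) G.
have he b : is_hom (e b) by apply: is_hom_comp hG; apply: is_hom_comp.
have DD b v : D b v *m D b v = D b v.
  rewrite /D mulmx_block !mul0mx !mulmx0 !addr0 !add0r -!scalar_mxM.
  by case: b; rewrite !(mulr1, mulr0).
have ee b v : e b v *m e b v = e b v.
  rewrite /e /hcomp !mulmxA -(mulmxA _ (G v)) [G v *m _]GF mulmx1.
  by rewrite -(mulmxA (F v)) DD.
have D1 b : coef 0 (bvec k i L 0 i *m e b i) != 0 -> forall v, D b v = 1%:M.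
  move=> hb v; have := idempotent_unit (ee b v) (endo_uniserial_unit (he b) hb v).
  move/(congr1 (mulmx (G v))) => /(congr1 (mulmxr (F v))) /=.
  rewrite /e /hcomp !mulmxA [G v *m _]GF mul1mx -mulmxA [G v *m _]GF !mulmx1.
  by rewrite [G v *m _]GF.
have eT b v : e b v + e (~~ b) v = 1%:M.
  rewrite /e /hcomp -mulmxDl -mulmxDr -[RHS]FG; congr (_ *m _).
  rewrite /D add_block_mx !addr0 -!raddfD /=.
  by case: b; rewrite /= ?addr0 ?add0r -scalar_mx_block mulmx1.
have : coef 0 (bvec k i L 0 i *m e true i) + coef 0 (bvec k i L 0 i *m e false i) != 0.
  have cD (x y : 'rV[k]_(udim i L i)) : coef 0 x + coef 0 y = coef 0 (x + y).
    by rewrite /coef mulmxDl [RHS]mxE.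
  by rewrite cD -mulmxDr (eT true) mulmx1 coef_bvec // eqxx oner_eq0.
case: (eqVneq (coef 0 (bvec k i L 0 i *m e true i)) 0) => [-> | + _].
  rewrite add0r => /D1/(_ v1)/matrixP/(_ (lshift _ (Ordinal h1)) (lshift _ (Ordinal h1))).
  by rewrite /D block_mxEul !mxE !eqxx => /eqP; rewrite eq_sym oner_eq0.
move=> /D1/(_ v2)/matrixP/(_ (rshift _ (Ordinal h2)) (rshift _ (Ordinal h2))).
by rewrite /D block_mxEdr !mxE !eqxx => /eqP; rewrite eq_sym oner_eq0.
Qed.

(** M is the direct sum of the image of [f] and the kernel of [r]; indecomposability leaves no room
    for the kernel. *)
Lemma split_iso l M N (f : hom N M) (r : hom M N) : is_hom f -> is_hom r ->
    (forall v, f v *m r v = 1%:M) -> is_module l N -> nonzero N ->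
  indecomposable l M -> iso M N.
Proof.
move=> hf hr fr mN nN [mM _ hM].
pose K v := row_base (kermx (r v)).
pose Kr := @Rep k n (fun v => \rank (kermx (r v)))
  (fun v => K v *m rmap M v *m pinvmx (K (ordS v))).
have subK v m (A : 'M_(m, _)) : A *m r v = 0 -> A *m pinvmx (K v) *m K v = A.
  by move=> h; rewrite mulmxKpV // eq_row_base; apply/sub_kermxP.
have Kr0 v : K v *m r v = 0 by apply/sub_kermxP; rewrite eq_row_base.
have hK : @is_hom _ _ Kr M K.
  move=> v; rewrite /= subK // -mulmxA -hr mulmxA Kr0 mul0mx //.
have freeK v : K v *m pinvmx (K v) = 1%:M by rewrite mulmxVp // row_base_free.
have mK : is_module l Kr.
  move=> v; have := hom_pth hK (erefl (iter l.+1 (@ordS n) v)).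
  rewrite /pth /eq_rect mM mulmx0 => /(congr1 (mulmxr (pinvmx (K (iter l.+1 (@ordS n) v))))).
  by rewrite /mulmxr -mulmxA freeK mulmx1 mul0mx => <-.
have r1 v : (1%:M - r v *m f v) *m r v = 0.
  by rewrite mulmxBl mul1mx -mulmxA fr mulmx1 subrr.
case: (boolP [exists v, (0 < rdim Kr v)%N]) => [/existsP nK|nK].
  case: hM; exists N, Kr; split=> //; apply: iso_sym.
  apply: (@iso_of_inverse _ _ (dsum N Kr) M (fun v => col_mx (f v) (K v))
    (fun v => row_mx (r v) ((1%:M - r v *m f v) *m pinvmx (K v)))) => v.
  - rewrite mul_col_mx mul_block_col !mul0mx addr0 add0r.
    by congr col_mx; [exact: hf | exact: hK].
  - have := freeK v; move: (pinvmx (K v)) => p fp.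
    rewrite mul_col_row [f v *m r v]fr Kr0 !mulmxA !mulmxBr !mulmx1 !mulmxA fr Kr0.
    by rewrite mul1mx subrr !mul0mx subr0 [K v *m p]fp -scalar_mx_block.
  - by rewrite mul_row_col subK // addrC subrK.
apply: (@iso_of_inverse _ _ _ _ r f hr _ fr) => v.
apply/eqP; rewrite eq_sym -subr_eq0 -(subK _ _ _ (r1 v)).
have -> : K v = 0.
  apply/matrixP => a; have := ltn_ord a; move: nK; rewrite negb_exists => /forallP/(_ v) /=.
  by rewrite -eqn0Ngt => /eqP {2}->.
by rewrite mulmx0.
Qed.

Lemma split_iso_unit l M N (f : hom N M) (r : hom M N) : is_hom f -> is_hom r ->
    (forall v, f v *m r v \in unitmx) -> is_module l N -> nonzero N ->
  indecomposable l M -> iso M N.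
Proof.
move=> hf hr fr mN nN hM.
have hg : is_hom (fun v => invmx (f v *m r v)).
  by apply: (is_hom_inv (is_hom_comp hf hr)) => v; rewrite /hcomp ?mulmxV ?mulVmx.
apply: (split_iso hf (is_hom_comp hr hg)) => // v.
by rewrite /hcomp mulmxA mulmxV.
Qed.

Lemma iter_coext i L w v (ew : iter L.-1 (@ordS n) i = w) (b : 'I_(udim i L v)) :
  iter (L.-1 - (uni_off i v + b * n)) (@ordS n) v = w.
Proof.
set s := (_ + _)%N; transitivity (iter (L.-1 - s) (@ordS n) (iter s (@ordS n) i)).
  by rewrite iter_off.
rewrite -iterD subnK // /s.
by have := ltn_ord b; rewrite ltn_udim; lia.
Qed.

(* Dually to [ext], a linear form phi on M_w with w the socle vertex induces the
   map sending y to the vector with coordinates phi (y . path (L-1-s)). *)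
Definition coext M i (L : nat) w (ew : iter L.-1 (@ordS n) i = w)
    (phi : 'cV[k]_(rdim M w)) : hom M (U i L) :=
  fun v => \matrix_(a < rdim M v, b < udim i L v) (pth M (iter_coext ew b) *m phi) a 0.

Lemma coext_bvec M i L w (ew : iter L.-1 (@ordS n) i = w) (phi : 'cV[k]_(rdim M w)) s v
    (e : iter (L.-1 - s) (@ordS n) v = w) : iter s (@ordS n) i = v -> (s < L)%N ->
  coext ew phi v *m (bvec k i L s v)^T = pth M e *m phi.
Proof.
move=> es h; have [b eb] := udim_index es h.
rewrite [in LHS]eb -delta_bvec trmx_delta -colE; apply/colP => a.
by rewrite !mxE (pth_irr M (iter_coext ew b) e) ?eb.
Qed.

Lemma rmap_bvec0 i L v : rmap (U i L) v *m (bvec k i L 0 (ordS v))^T = 0.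
Proof.
apply/colP => a; rewrite !mxE big1 // => b _; rewrite !mxE.
by case: (0%N =P _) => [<-|]; rewrite ?mulr0 // mul0r.
Qed.

Lemma is_hom_coext M i L w (ew : iter L.-1 (@ordS n) i = w) (phi : 'cV[k]_(rdim M w)) :
  (0 < L)%N -> (forall v, pathm M v L = 0) -> is_hom (coext ew phi).
Proof.
move=> hL hM v; apply: trmx_inj; apply/row_matrixP => b; rewrite -!tr_col; congr trmx.
rewrite !colE -[delta_mx b 0]trmx_delta delta_bvec -!mulmxA.
have := iter_off i (ordS v) b; have := ltn_ord b; rewrite ltn_udim.
move: (iter_coext ew b); set s := (_ + _)%N; move: s => s e hs es.
rewrite (coext_bvec _ _ e) // [RHS]mulmxA.
have e1 : iter (L.-1 - s).+1 (@ordS n) v = w by rewrite iterSr.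
(* In coordinate 0 the image of an arrow of the uniserial module vanishes, and the other side
   contains a path of length L on M. *)
rewrite (pthSl _ _ e1); case: (posnP s) => s0.
  rewrite [in LHS]s0 rmap_bvec0 mulmx0 pth_eq0 ?mul0mx // s0 subn0 prednK //.
have es1 : iter s.-1 (@ordS n) i = v.
  by apply: (bij_inj (@ordS_bij n)); rewrite -iterS prednK.
have e2 : iter (L.-1 - s.-1) (@ordS n) v = w.
  by rewrite -e1; congr iter; lia.
rewrite -[in LHS](prednK s0) rmap_bvec ?prednK // (coext_bvec _ _ e2) //; last lia.
by congr (_ *m _); apply: pth_irr; lia.
Qed.

Lemma indecomposable_uniserial l M : indecomposable l M ->
  exists i L, (0 < L <= l.+1)%N /\ iso M (U i L).
Proof.
move=> hM; have [mM [v0 nM] _] := hM.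
have hex : exists m, [forall v, pathm M v m == 0].
  by exists l.+1; apply/forallP => v; apply/eqP/mM.
case: (ex_minnP hex) => L /forallP hL minL.
have L1 : (L <= l.+1)%N by apply: minL; apply/forallP => v; apply/eqP/mM.
have L0 : (0 < L)%N.
  rewrite lt0n; apply/eqP => e; have := hL v0; rewrite e /= => /eqP/matrixP.
  move=> /(_ (Ordinal nM) (Ordinal nM)); rewrite !mxE eqxx => /eqP.
  by rewrite oner_eq0.
have /forallPn[i] : ~~ [forall v, pathm M v L.-1 == 0].
  by apply/negP => /minL; lia.
case/matrix0Pn=> a [b ab].
pose w := iter L.-1 (@ordS n) i.
(* Scaled so that [phi] takes the value 1 on x times the path of length L-1; the composite of [ext]
   and [coext] then has coefficient 1 at e_0 and is invertible. *)
pose x : 'rV[k]_(rdim M i) := (pathm M i L.-1 a b)^-1 *: delta_mx 0 a.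
pose phi : 'cV[k]_(rdim M w) := delta_mx b 0.
have hx : x *m pathm M i L = 0 by rewrite (eqP (hL i)) mulmx0.
have hext := is_hom_ext hx.
have hco : is_hom (coext (erefl w) phi).
  by apply: is_hom_coext => // v; apply/eqP.
exists i, L; rewrite L0 L1; split=> //.
apply: (@split_iso_unit l _ _ (ext L x) (coext (erefl w) phi)) => //.
- move=> v; apply: (endo_uniserial_unit (is_hom_comp hext hco)).
  have e0 : iter (L.-1 - 0) (@ordS n) i = w by rewrite subn0.
  rewrite /hcomp mulmxA ext_bvec0 // /coef -mulmxA (coext_bvec _ _ e0) //.
  have -> : pth M e0 = pth M (erefl w) by apply: pth_irr; rewrite subn0.
  rewrite /pth /= /x /phi -scalemxAl mxE -colE -rowE !mxE mulVf ?oner_eq0 //.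
- exact: uniserial_module.
- exact: uniserial_nonzero.
Qed.

End Classification.

(** * Simple-minded systems as length functions *)

Section SimpleMindedSystems.
Variables (k : fieldType) (n : nat).
Local Notation U := (@uniserial k n).
Implicit Types (X Y : rep k n) (i j : 'I_n) (lam : 'I_n -> nat).

(** [lam i] is the length of the member with top [i]. Orthogonality and the endomorphism condition
    are merged into one clause; density is derived from it. *)
Definition sms_lengths l lam :=
  (forall i, 0 < lam i <= l) /\
  forall i j s, stable_pos l i (lam i) j (lam j) s -> i = j /\ s = 0.

Definition uniserial_family lam X := exists i, iso X (U i (lam i)).

Lemma iter_ordS_inj s : injective (iter s (@ordS n)).
Proof. by elim: s => [|s IHs] i j //= /(bij_inj (@ordS_bij n))/IHs. Qed.

Lemma iter_ordS_mul d i : iter (d * n) (@ordS n) i = i.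
Proof. by apply/iter_ordSP; rewrite modnMl uni_offii. Qed.

(** [iter (lam i) (@ordS n) i] is the vertex after the socle. If two members shared a socle, the
    shorter would embed in the longer, and this inclusion is stably non-zero, at position
    [lam j - lam i]. *)
Lemma sms_lengths_socle_inj l lam : sms_lengths l lam ->
  injective (fun i => iter (lam i) (@ordS n) i).
Proof.
case=> hl ho.
suff lem i j : iter (lam i) (@ordS n) i = iter (lam j) (@ordS n) j -> lam i <= lam j -> i = j.
  by move=> i j e; case: (leqP (lam i) (lam j)) => h; [|symmetry]; apply: lem => //; apply: ltnW.
move=> e h; suff /ho[] : stable_pos l i (lam i) j (lam j) (lam j - lam i) by [].
split; have := hl i; have := hl j; try lia.
by move=> _ _; apply: (@iter_ordS_inj (lam i)); rewrite -iterD subnKC.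
Qed.

(* The targets x+1, ..., x+L of a module with interval [x, x+L) are hit by L
   distinct starting points modulo dn, only L-1 of which can lie in (x, x+L). *)
Lemma sms_lengths_dense d lam i L : sms_lengths (d * n) lam -> 0 < L <= d * n ->
  exists j s, stable_pos (d * n) i L j (lam j) s.
Proof.
move=> hg /andP[L0 Ll]; have [g fg gf] := injF_bij (sms_lengths_socle_inj hg).
have [hl _] := hg; set l := d * n in hg hl Ll *.
(* For 1 <= t <= L, [j t] is the top of the member whose interval ends just before i + t, and [u t]
   is the start of that interval relative to [i], reduced into [0, dn). *)
pose j t := g (iter t (@ordS n) i).
have hj t : iter (lam (j t)) (@ordS n) (j t) = iter t (@ordS n) i by apply: gf.
pose u t := if t < lam (j t) then t + l - lam (j t) else t - lam (j t).
(* A start at 0 or at least L yields a stable map; otherwise [u] injects L numbers into 1, ...,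
   L-1. *)
case: (boolP (has (fun t => (u t == 0) || (L <= u t)) (iota 1 L))) => [/hasP[t]|/hasPn no].
  rewrite mem_iota => ht hu; exists (j t), (lam (j t) - t).
  have := hl (j t); move: hu; rewrite /u; case: ifP => h hu hlt.
    split; try lia.
    by apply: (@iter_ordS_inj t); rewrite -iterD subnKC ?hj //; lia.
  have e : lam (j t) = t by lia.
  rewrite e subnn; split; try lia.
  by apply: (@iter_ordS_inj t); rewrite -[RHS]hj e.
have uj t : iter (u t) (@ordS n) i = j t.
  apply: (@iter_ordS_inj (lam (j t))); rewrite hj -iterD /u; have := hl (j t).
  case: ifP => h h'; last by rewrite subnKC //; lia.
  by rewrite subnKC ?iterD ?iter_ordS_mul //; lia.
have : size (map u (iota 1 L)) <= size (iota 1 L.-1).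
  apply: uniq_leq_size => [|x /mapP[t ht ->]].
    rewrite map_inj_in_uniq ?iota_uniq // => t t'; rewrite !mem_iota => ht ht' e.
    have ej : j t = j t' by rewrite -!uj e.
    have := hl (j t); have := hl (j t'); move: e; rewrite /u ej.
    by case: ifP => h; case: ifP => h'; lia.
  by have := no t ht; rewrite mem_iota; lia.
by rewrite size_map !size_iota; lia.
Qed.

Lemma iso_uniserial_family lam X Y : iso X Y -> uniserial_family lam X -> uniserial_family lam Y.
Proof. by move=> e [i hi]; exists i; apply: iso_trans (iso_sym e) hi. Qed.

Lemma nonprojective_uniserial l X : indecomposable l X -> ~ projective l X ->
  exists i L, 0 < L <= l /\ iso X (U i L).
Proof.
move=> hX pX; have [i [L [hL e]]] := indecomposable_uniserial hX.
exists i, L; split=> //; case: (eqVneq L l.+1) => [eL|]; last lia.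
case: pX; apply: iso_projective (iso_sym e) _; rewrite eL.
exact: uniserial_projective.
Qed.

Lemma sms_lengths_sms d lam : sms_lengths (d * n) lam -> is_sms (d * n) (uniserial_family lam).
Proof.
move=> hg; have [hl ho] := hg; have hl0 i : 0 < lam i by have := hl i; lia.
have hl1 i : lam i <= (d * n).+1 by have := hl i; lia.
split.
- exact: iso_uniserial_family.
- move=> X [i e]; split.
    apply: iso_indecomposable (iso_sym e) _; apply: uniserial_indecomposable.
    by rewrite hl0 hl1.
  by move=> /(iso_projective e); apply: uniserial_not_projective.
- move=> X Y [i ei] [j ej] XY; apply: (iso_sHom0 (iso_sym ei) (iso_sym ej)).
  apply/sHom0_uniserial => // s /ho [ij _]; apply: XY; rewrite -ij in ej.
  exact: iso_trans ei (iso_sym ej).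
- move=> X [i e]; apply: iso_sEnd_k (iso_sym e) _.
  by apply/sEnd_k_uniserial => // s /ho [].
- move=> X hX pX; have [i [L [hL e]]] := nonprojective_uniserial hX pX.
  have [j [s hs]] := sms_lengths_dense i hg hL.
  exists (U j (lam j)); split; first by exists j; apply: iso_refl.
  move=> /(iso_sHom0 e (@iso_refl _ _ _)) /sHom0_uniserial h.
  by apply: (h _ _ s hs); [case/andP: hL | ].
Qed.

Lemma sms_has_lengths l (S : rep k n -> Prop) : 0 < l -> is_sms l S ->
  exists lam, sms_lengths l lam /\ forall X, S X <-> uniserial_family lam X.
Proof.
move=> l0 [Siso Sind Sort Send Smax].
have Su X : S X -> exists i L, 0 < L <= l /\ iso X (U i L).
  by move=> /Sind[]; apply: nonprojective_uniserial.
pose T i L := 0 < L <= l /\ S (U i L).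
have ortho i L j L' s : T i L -> T j L' -> stable_pos l i L j L' s ->
    [/\ i = j, L = L' & s = 0].
  move=> [hL Si] [hL' Sj] hs.
  have nh : ~ sHom0 l (U i L) (U j L').
    by move=> /sHom0_uniserial h; apply: (h _ _ s hs); lia.
  case: (boolP ((i == j) && (L == L'))) => [/andP[/eqP ij /eqP LL]|ne].
    split=> //; move: hs; rewrite -ij -LL.
    by have /(sEnd_k_uniserial _ _ hL) := Send _ Si; apply.
  case: nh; apply: Sort => // /iso_uniserial_inj[||ij LL]; try lia.
  by rewrite ij LL !eqxx in ne.
have exT i : exists L, T i L.
  have hl : 0 < l <= l by rewrite l0 leqnn.
  have hl1 : 0 < l <= l.+1 by lia.
  (* Density is tested on the module of length l with top [i]: only position 0 can occur, so the
     member found has top [i]. *)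
  have [Y [SY nY]] := Smax _ (uniserial_indecomposable k i hl1) (uniserial_not_projective hl).
  have [j [L [hL e]]] := Su Y SY.
  case: (eqVneq j i) => [ji|ji]; first by exists L; split=> //; rewrite -ji; apply: Siso e SY.
  case: nY; apply: iso_sHom0 (@iso_refl _ _ _) (iso_sym e) _.
  apply/sHom0_uniserial; try lia.
  move=> s [es _ _ s3]; have s0 : s = 0 by lia.
  by rewrite s0 /= in es; rewrite es eqxx in ji.
have [lam hlam] := fin_all_exists exT; exists lam; split.
  split=> [i|i j s hs]; first by case: (hlam i).
  by have [] := ortho _ _ _ _ _ (hlam i) (hlam j) hs.
move=> X; split=> [SX|[i e]]; last by apply: Siso (iso_sym e) _; case: (hlam i).
have [i [L [hL e]]] := Su X SX; exists i; have TL : T i L by split=> //; apply: Siso e SX.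
suff -> : lam i = L by [].
have [hl _] := hlam i.
(* Of two modules with the same top the shorter is a quotient of the longer, and the quotient map is
   position 0. *)
have pos L1 L2 : 0 < L1 <= l -> 0 < L2 -> L2 <= L1 -> stable_pos l i L1 i L2 0.
  by move=> h1 h2 h3; split=> //; lia.
case: (leqP (lam i) L) => h.
  by have [] := ortho _ _ _ _ _ TL (hlam i) (pos _ _ hL _ h) => //; lia.
have [] := ortho _ _ _ _ _ (hlam i) TL (pos _ _ hl _ (ltnW h)) => //; lia.
Qed.

Lemma uniserial_family_inj lam lam' : (forall i, 0 < lam i) -> (forall i, 0 < lam' i) ->
  (forall X, uniserial_family lam X <-> uniserial_family lam' X) <-> lam =1 lam'.
Proof.
move=> h h'; split=> [e i|e X]; last by split=> [] [i hi]; exists i; rewrite ?e // -e.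
have /e[j] : uniserial_family lam (U i (lam i)) by exists i; apply: iso_refl.
by case/iso_uniserial_inj => // <-.
Qed.

End SimpleMindedSystems.

(** * Non-crossing partitions and arcs *)

Section Arcs.
Variable n : nat.
Implicit Types (i j x y a b : 'I_n) (r : 'I_n -> nat) (P : {set {set 'I_n}}).

Definition in_arc r i j := uni_off i j < r i.

Lemma uni_offP i j :
  [/\ i < n, j < n & (i <= j /\ uni_off i j + i = j) \/ (j < i /\ uni_off i j + i = j + n)].
Proof.
have hi := ltn_ord i; have hj := ltn_ord j; split=> //.
by rewrite uni_offE; case: leqP => h; [left|right]; lia.
Qed.

(** This is the orthogonality of [sms_lengths] for d = 1, where the only candidate position is
    [uni_off j i]. An arc that starts inside arc [j] and reaches its last vertex must go on to [j]
    itself. *)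
Definition arc_noncrossing r :=
  (forall i, 0 < r i <= n) /\
  forall i j, i <> j -> uni_off j i < r j -> r j <= uni_off j i + r i ->
    n < uni_off j i + r i.

Definition block_arc P i := (uni_off i (kvert P i)).+1.

Lemma iter_ord_predE s i j : iter s (@ord_pred n) i = j <-> iter s (@ordS n) j = i.
Proof.
have pK m x : iter m (@ordS n) (iter m (@ord_pred n) x) = x.
  elim: m x => // m IHm x; rewrite [iter m.+1 (@ord_pred n) x]iterSr iterS IHm.
  exact: ord_predK.
have sK m x : iter m (@ord_pred n) (iter m (@ordS n) x) = x.
  elim: m x => // m IHm x; rewrite [iter m.+1 (@ordS n) x]iterSr iterS IHm.
  exact: ordSK.
by split=> <-.
Qed.

Lemma iter_ordS_n i : iter n (@ordS n) i = i.
Proof. by apply/iter_ordSP; rewrite modnn uni_offii. Qed.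

Lemma uni_off_iter i j : iter (uni_off i j) (@ordS n) i = j.
Proof. by have := iter_off i j 0; rewrite mul0n addn0. Qed.

(** * The arcs of a non-crossing partition *)

Section Noncrossing.
Variable P : {set {set 'I_n}}.
Hypothesis hP : noncrossing P.

Lemma mem_pblock_noncrossing i j : (j \in pblock P i) = (pblock P i == pblock P j).
Proof.
have [/and3P[/eqP cov tri _] _] := hP.
by rewrite eq_pblock // cov inE.
Qed.

Lemma kdist_bounds i : 0 < kdist P i <= n.
Proof.
rewrite /kdist /= -[X in _ <= X](size_iota 0 n) -has_find; apply/hasP.
have n0 : 0 < n by have := ltn_ord i; lia.
exists n.-1; first by rewrite mem_iota; lia.
rewrite -iterS (prednK n0) mem_pblock_noncrossing.
by have /iter_ord_predE -> := iter_ordS_n i.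
Qed.

Lemma pblock_kvert i : pblock P (kvert P i) = pblock P i.
Proof.
have hk := kdist_bounds i; apply/esym/eqP; rewrite -mem_pblock_noncrossing /kvert.
have := @nth_find _ 0 (fun m => iter m.+1 (@ord_pred n) i \in pblock P i) (iota 0 n).
rewrite /kdist /= in hk *; rewrite has_find size_iota => /(_ hk).
by rewrite nth_iota.
Qed.

Lemma uni_off_kvert i : uni_off i (kvert P i) = (n - kdist P i) %% n.
Proof.
have hk := kdist_bounds i.
have /iter_ord_predE e := erefl (kvert P i).
apply/eqP; rewrite eq_sym; apply/iter_ordSP.
move: (kdist P i) (kvert P i) hk e => m v hk <-.
by rewrite -iterD subnK ?iter_ordS_n //; lia.
Qed.

(** A vertex of the block outside the arc would be met before [kvert P i] on the way back from
    [i]. *)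
Lemma arc_pblock i j : pblock P i = pblock P j -> in_arc (block_arc P) i j.
Proof.
move=> /eqP; rewrite -mem_pblock_noncrossing => ij.
rewrite /in_arc /block_arc ltnS; have [-> | ne] := eqVneq j i; first by rewrite uni_offii.
have nij : (i : nat) <> j by move=> /ord_inj e; rewrite e eqxx in ne.
have o : 0 < uni_off i j < n by have [] := uni_offP i j; lia.
have em : iter (n - uni_off i j) (@ord_pred n) i = j.
  apply/iter_ord_predE; rewrite -{2}(uni_off_iter i j) -iterD subnK ?iter_ordS_n //; lia.
have km : kdist P i <= n - uni_off i j.
  rewrite /kdist leqNgt; apply/negP => h.
  have hm : (n - uni_off i j).-1 < find (fun m => iter m.+1 (@ord_pred n) i \in pblock P i)
    (iota 0 n) by lia.
  have := before_find 0 hm; rewrite nth_iota; last lia.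
  by rewrite add0n prednK ?em ?ij //; lia.
have hk := kdist_bounds i.
by rewrite uni_off_kvert modn_small; lia.
Qed.

Lemma mem_hat i j : (j \in hat P i) = in_arc (block_arc P) i j.
Proof.
rewrite /in_arc /block_arc ltnS uni_off_kvert; apply/imsetP/idP => [[s]|h].
  rewrite inE => hs ->; suff -> : uni_off i (iter s (@ordS n) i) = s by [].
  by have /iter_ordSP/eqP <- := erefl (iter s (@ordS n) i); rewrite modn_small.
exists (Ordinal (uni_off_lt i j)); rewrite ?inE //=.
by rewrite uni_off_iter.
Qed.

(** Cutting the circle elsewhere permutes the four points cyclically, and the linear condition
    applies to each of the four rotations. *)
Lemma noncrossing_circular a x b y : pblock P a = pblock P b -> pblock P x = pblock P y ->
  0 < uni_off a x < uni_off a b -> uni_off a b < uni_off a y -> pblock P a = pblock P x.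
Proof.
move=> ab xy h1 h2; have [_ nc] := hP.
have [] := uni_offP a x; have [] := uni_offP a b; have [] := uni_offP a y.
move=> _ hy ey _ hb eb ha hx ex.
have [c|[c|[c|c]]] : (a < x < b /\ b < y) \/ (y < a < x /\ x < b) \/ (b < y < a /\ a < x)
   \/ (x < b < y /\ y < a) by lia.
- by apply: (nc a x b y); lia || auto.
- by rewrite xy; symmetry; apply: (nc y a x b); lia || auto.
- by rewrite ab xy; apply: (nc b y a x); lia || auto.
- by rewrite ab; symmetry; apply: (nc x b y a); lia || auto.
Qed.

(** The ends [j] and [kvert P j] of an arc share a block, so a different block with points inside
    and outside the arc would cross it: arcs are unions of blocks. *)
Lemma arc_pblock_eq j x y : pblock P x = pblock P y ->
  in_arc (block_arc P) j x = in_arc (block_arc P) j y.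
Proof.
suff lem u v : pblock P u = pblock P v -> in_arc (block_arc P) j u -> in_arc (block_arc P) j v.
  by move=> e; apply/idP/idP; apply: lem.
move=> uv hu; case: (eqVneq (pblock P j) (pblock P u)) => [ju|/eqP ju].
  by apply: arc_pblock; rewrite ju.
have nj : (j : nat) <> u by move/ord_inj => e; case: ju; rewrite e.
have nk : (kvert P j : nat) <> u.
  by move/ord_inj => e; case: ju; rewrite -e pblock_kvert.
apply/negPn/negP => hv; case: ju.
apply: (@noncrossing_circular j u (kvert P j) v) => //; rewrite ?pblock_kvert //;
move: hu hv; rewrite /in_arc /block_arc; have [] := uni_offP j v; have [] := uni_offP j u;
  by have [] := uni_offP j (kvert P j); lia.
Qed.

(** Take for [i] the first vertex of the block of [x] met after [y]; then [kvert P i] is the last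
    one before [y], so the arc stops short of [y]. *)
Lemma exists_arc_avoiding x y : pblock P x <> pblock P y ->
  exists2 i, pblock P i = pblock P x & ~~ in_arc (block_arc P) i y.
Proof.
move=> xy; case: (arg_minnP (P := fun i => pblock P i == pblock P x) (uni_off y) (eqxx _)).
move=> i /eqP ix mi; exists i => //; apply/negP.
have := mi (kvert P i); rewrite pblock_kvert ix eqxx => /(_ isT).
have ni : (i : nat) <> y by move/ord_inj => e; case: xy; rewrite -ix e.
rewrite /in_arc /block_arc; have [] := uni_offP y i; have [] := uni_offP y (kvert P i).
by have [] := uni_offP i y; have [] := uni_offP i (kvert P i); lia.
Qed.

Lemma disjoint_hat_pblock i x :
  [disjoint hat P i & pblock P x] = ~~ in_arc (block_arc P) i x.
Proof.
have xx : x \in pblock P x by rewrite mem_pblock_noncrossing.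
apply/idP/idP => [/disjointFl/(_ xx)|hx]; first by rewrite mem_hat => ->.
apply/pred0P => y /=; rewrite mem_hat mem_pblock_noncrossing.
by apply/andP => [[hy /eqP xy]]; rewrite (arc_pblock_eq i xy) hy in hx.
Qed.

(** Each arc contains the start of the other, so together they go round the whole circle. *)
Lemma pblock_arcs_cover i j y : pblock P i = pblock P j -> i <> j ->
  in_arc (block_arc P) i y || in_arc (block_arc P) j y.
Proof.
move=> ij nij; have nij' : (i : nat) <> j by move/ord_inj.
have := arc_pblock ij; have := arc_pblock (esym ij); rewrite /in_arc.
by have [] := uni_offP i j; have [] := uni_offP j i; have [] := uni_offP i y;
  have [] := uni_offP j y; lia.
Qed.

Lemma eq_pblock_arcs x y :
  pblock P x = pblock P y <-> forall m, in_arc (block_arc P) m x = in_arc (block_arc P) m y.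
Proof.
split=> [e m|e]; first exact: arc_pblock_eq.
apply/eqP/negPn/negP => /eqP /exists_arc_avoiding[i ix /negP[]].
by rewrite -e; apply: arc_pblock.
Qed.

(** If arc [i] started in arc [j] and reached its end without coming round to [j], the ends of the
    two arcs would cross unless all lie in one block; but in one block arc [i] contains [j]. *)
Lemma block_arc_noncrossing : arc_noncrossing (block_arc P).
Proof.
split=> [i|i j ij]; first by rewrite /block_arc uni_off_lt.
have ij' : (i : nat) <> j by move/ord_inj.
move=> h1 h2; rewrite ltnNge; apply/negP => h3.
suff /arc_pblock : pblock P i = pblock P j.
  by rewrite /in_arc; have [] := uni_offP i j; have [] := uni_offP j i; lia.
have [e|e] := eqVneq (kvert P i) (kvert P j).
  by rewrite -pblock_kvert e pblock_kvert.
have [e'|e'] := eqVneq i (kvert P j); first by rewrite {1}e' pblock_kvert.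
have {}e : (kvert P i : nat) <> kvert P j by move/ord_inj/eqP; rewrite (negbTE e).
have {}e' : (i : nat) <> kvert P j by move/ord_inj/eqP; rewrite (negbTE e').
symmetry; apply: (@noncrossing_circular j i (kvert P j) (kvert P i)); rewrite ?pblock_kvert //;
  move: h1 h2 h3; rewrite /block_arc; have [] := uni_offP j i; have [] := uni_offP j (kvert P i);
  by have [] := uni_offP i (kvert P i); have [] := uni_offP j (kvert P j); lia.
Qed.

End Noncrossing.

Lemma noncrossing_arc_inj P P' : noncrossing P -> noncrossing P' ->
  block_arc P =1 block_arc P' -> P = P'.
Proof.
move=> hP hP' e.
have R x y : (pblock P x == pblock P y) = (pblock P' x == pblock P' y).
  apply/eqP/eqP => [/(eq_pblock_arcs hP) h|/(eq_pblock_arcs hP') h];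
    [apply/(eq_pblock_arcs hP') | apply/(eq_pblock_arcs hP)] => m;
    by have := h m; rewrite /in_arc !e.
have [pP _] := hP; have [pP' _] := hP'.
rewrite -(equivalence_partition_pblock pP) -(equivalence_partition_pblock pP').
apply: eq_imset => x; apply/setP => y.
by rewrite !inE (mem_pblock_noncrossing hP) (mem_pblock_noncrossing hP') R.
Qed.

(* The blocks are the classes of the vertices that are not separated by any arc. *)
Lemma exists_noncrossing r : arc_noncrossing r ->
  exists P, noncrossing P /\ block_arc P =1 r.
Proof.
move=> [rb nc]; pose R x y := [forall m, in_arc r m x == in_arc r m y].
have RP x y : reflect (forall m, in_arc r m x = in_arc r m y) (R x y).
  by apply: (iffP forallP) => h m; [rewrite (eqP (h m)) | rewrite h].
have Req : {in setT & &, equivalence_rel R}.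
  move=> x y z _ _ _; split; first by apply/RP.
  by move=> /RP xy; apply/RP/RP => h m; rewrite -h xy.
pose P := equivalence_partition R setT.
have mP x y : (y \in pblock P x) = R x y.
  by rewrite (pblock_equivalence_partition Req) ?inE.
have partP : partition P setT by apply: equivalence_partitionP.
have bP x y : pblock P x = pblock P y <-> R x y.
  have [/eqP cov tri _] := and3P partP.
  by rewrite -mP -eq_pblock ?cov ?inE //; split=> /eqP.
have hP : noncrossing P.
  (* An arc through [a] and [b] is connected, so it contains [x] or [y] and hence both; the same
     holds with the pairs exchanged. *)
  split=> // a x b y ax xb xy /bP/RP ab /bP/RP xy'; apply/bP/RP => m.
  have := ab m; have := xy' m; rewrite /in_arc.
  by have [] := uni_offP m a; have [] := uni_offP m x; have [] := uni_offP m b;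
    have [] := uni_offP m y; lia.
exists P; split=> // i.
have i0 := rb i; have re : (r i).-1 < n by lia.
pose e := iter (r i).-1 (@ordS n) i.
have ie : uni_off i e = (r i).-1.
  by have /iter_ordSP/eqP <- := erefl e; rewrite modn_small.
(* No arc separates the two ends of arc [i]: non-crossing is applied to [i] and [m] in both
   orders. *)
have Re : R e i.
  apply/RP => m; have [->|/eqP mi] := eqVneq m i; first by rewrite /in_arc ie uni_offii; lia.
  have mi' : (m : nat) <> i by move/ord_inj.
  have := nc i m (nesym mi); have := nc m i mi; rewrite /in_arc.
  have := rb m; move: ie; have [] := uni_offP m e; have [] := uni_offP m i.
  by have [] := uni_offP i m; have [] := uni_offP i e; lia.
have : in_arc (block_arc P) i e by apply: arc_pblock => //; apply/esym/bP.
have : in_arc r i (kvert P i).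
  have /bP/RP/(_ i) -> := pblock_kvert hP i.
  by rewrite /in_arc uni_offii; lia.
by rewrite /in_arc /block_arc ie; lia.
Qed.

End Arcs.

(** * Short and long arcs *)

Section LengthFunctions.
Variables (n d : nat).
Hypothesis hd : 0 < d.
Implicit Types (i j x y z : 'I_n) (r lam : 'I_n -> nat) (e : pred 'I_n)
  (P : {set {set 'I_n}}).

Definition long_length r e i := r i + (if e i then d.-1 else 0) * n.

(** Comparison of the multiples tn and (d-1)n of n, stated so that linear arithmetic can afterwards
    treat both products as unknowns. *)
Lemma multiple_cases t : (t * n = 0 \/ n <= t * n) /\
  (t * n + 2 * n <= d.-1 * n \/ t * n + n = d.-1 * n \/
   t * n = d.-1 * n \/ d.-1 * n + n <= t * n).
Proof.
split; first by case: t => [|t]; [left | right; rewrite leq_pmull].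
have [h|[h|[h|h]]] : t + 2 <= d.-1 \/ t + 1 = d.-1 \/ t = d.-1 \/ d.-1 + 1 <= t by lia.
- by left; rewrite -mulnDl leq_mul2r h orbT.
- by right; left; rewrite -h mulnDl mul1n.
- by right; right; left; rewrite h.
by right; right; right; rewrite -[X in _ + X]mul1n -mulnDl leq_mul2r h orbT.
Qed.

Lemma dn_split : d * n = d.-1 * n + n.
Proof. by rewrite -{1}(prednK hd) mulSn addnC. Qed.

(* The long modules of L_{p,z} (b = true) and of S_{p,z} (b = false). *)
Definition long_at r z (b : bool) : pred 'I_n := fun i => in_arc r i z && (b || (i != z)).

(** For d >= 2, a stable position between two distinct short arcs would make each contain the start
    of the other. They would cover the circle, so one would pass through [z] without starting there
    and be long. The other cases are likewise linear arithmetic. *)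
Lemma sms_lengths_long_length r z b : arc_noncrossing r ->
  sms_lengths (d * n) (long_length r (long_at r z b)).
Proof.
move=> [rb nc]; rewrite /long_length /long_at; split=> [i|i j s [es]].
  by rewrite dn_split; have := rb i; case: ifP => _; rewrite ?mul0n; move: (d.-1 * n); lia.
have eij : i = j <-> (i : nat) = j by split=> [->|/ord_inj].
have -> : s = uni_off j i + (s %/ n) * n by apply: iter_ordS_eq.
have := multiple_cases (s %/ n).
rewrite dn_split /in_arc; have := rb i; have := rb j; have := nc i j; rewrite eij.
have -> : (i != z) = (i != z :> nat) by [].
have -> : (j != z) = (j != z :> nat) by [].
have [a1 a2 a3] := uni_offP j z; have [b1 _ b3] := uni_offP i z.
have [_ _ c3] := uni_offP i j; have [_ _ f3] := uni_offP j i.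
have e0 c : (if c then d.-1 else 0) * n = if c then d.-1 * n else 0 by case: c.
rewrite !e0; move: (s %/ n * n) (d.-1 * n) => T D {e0} H1 H2 H3 [H4 H5].
clear rb nc es eij.
move: (uni_off j i) (uni_off i j) (uni_off i z) (uni_off j z) c3 f3 b3 a3 H1 H2 H3.
move: (nat_of_ord i) (nat_of_ord j) (nat_of_ord z) (r i) (r j) a1 a2 b1 H4 H5.
clear i j z r hd s; move=> i j z ri rj a1 a2 b1 H4 H5 dji dij diz djz c3 f3 b3 a3 H1 H2 H3.
case: b => /=; rewrite ?andbT; case: ifP => hj; case: ifP => hi h1 h2 h3.
all: by lia.
Qed.

Lemma sms_lengths_decomposition lam : sms_lengths (d * n) lam ->
  exists r e, [/\ arc_noncrossing r, lam =1 long_length r e &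
    1 < d -> forall i j, i <> j ->
      [/\ ~~ e i -> ~~ e j -> uni_off j i < r j -> uni_off j i + r i < r j,
          e i -> e j -> uni_off j i + r i <= n -> uni_off j i + r i < r j,
          ~~ e i -> e j -> uni_off j i + r i < n + r j
        & e i -> ~~ e j -> uni_off j i < r j -> n < uni_off j i + r i]].
Proof.
move=> [hl ho]; pose D := d.-1 * n; have eD : d * n = D + n := dn_split.
pose e : pred 'I_n := fun i => n < lam i; pose r i := if e i then lam i - D else lam i.
have n0 (i : 'I_n) : 0 < n by have := ltn_ord i; lia.
have longD i : e i -> D < lam i.
  rewrite /e ltnNge => h1; rewrite ltnNge; apply/negP => h2.
  (* Unless [lam i] exceeds (d-1)n, sending e_0 to e_n is a second stable endomorphism. *)
  suff /ho[_ ] : stable_pos (d * n) i (lam i) i (lam i) n by have := n0 i; lia.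
  by split; rewrite ?iter_ordS_n //; lia.
have ho' i j t : i <> j -> uni_off j i + t * n < lam j ->
    lam j <= uni_off j i + t * n + lam i -> uni_off j i + t * n + lam i <= D + n -> False.
  move=> ij h1 h2 h3; apply: ij.
  suff /ho[] : stable_pos (d * n) i (lam i) j (lam j) (uni_off j i + t * n) by [].
  by split; rewrite ?iter_off ?eD.
have hr i : 0 < r i <= n.
  by have := hl i; rewrite /r eD; case: ifP => [/longD|]; rewrite /e; lia.
have hlam i : lam i = r i + (if e i then D else 0).
  by rewrite /r; case: (e i) (longD i) => [/(_ isT)|_]; lia.
have D0 : D = d.-1 * n by [].
clearbody r; have ho0 i j ij := ho' i j 0 ij; have ho1 i j ij := ho' i j d.-1 ij.
exists r, e; split.
- split=> // i j ij; rewrite ltnNge => h1 h2; apply/negP => h3.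
  have := ho0 i j ij; have := ho1 i j ij; rewrite -D0 !hlam mul0n addn0.
  by have := hr i; have := hr j; case: (e i); case: (e j); lia.
- by move=> i; rewrite hlam /long_length; case: (e i).
move=> d1 i j ij; have nD : n <= D by rewrite /D leq_pmull //; lia.
(* The position with t = d-2 gives the condition on a short [i] and a long [j]; t = 0 suffices for
   the other three. *)
have D2 : d.-2 * n + n = D by rewrite addnC -mulSn prednK //; lia.
have := ho0 i j ij; have := ho1 i j ij; have := ho' i j d.-2 ij.
have := hr j; have := hr i; have := uni_off_lt j i; rewrite -D0 !hlam mul0n addn0.
clear -nD D2; move: (d.-2 * n) D2 => D2 eD2; clearbody D.
by move: (e i) (e j) => [] [] /= H4 H3 H2 H1 H0 H; split=> //; lia.
Qed.

Lemma sms_lengths_long_at lam : 0 < n -> sms_lengths (d * n) lam ->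
  exists P z b, noncrossing P /\ lam =1 long_length (block_arc P) (long_at (block_arc P) z b).
Proof.
move=> n0 /sms_lengths_decomposition[r [e [hr hlam he]]].
have [P [hP eP]] := exists_noncrossing hr; exists P.
suff [z [b ez]] : exists z b, long_length r e =1 long_length r (long_at r z b).
  exists z, b; split=> // i; rewrite hlam ez /long_length /long_at /in_arc !eP //.
(* For d = 1 long and short lengths coincide, so any [z] will do. *)
have [d1|d1] := leqP d 1.
  exists (Ordinal n0), true => i; rewrite /long_length.
  have d0 : d.-1 = 0 by lia.
  by rewrite d0 !if_same.
suff [z [b ez]] : exists z b, e =1 long_at r z b.
  by exists z, b => i; rewrite /long_length ez.
have {}he := he d1; have [rb _] := hr.
have neq i j : i != j -> (i : nat) <> j by move=> /eqP ij /ord_inj.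
(* If y lies in all long arcs and in some short one, then z, the start of a longest
   short arc through y, gives S_{p,z}. *)
have short_case y : (forall j, e j -> in_arc r j y) -> (exists2 i, ~~ e i & in_arc r i y) ->
    exists z b, e =1 long_at r z b.
  move=> hy [i0 ei0 i0y].
  case: (arg_maxnP (P := fun i => ~~ e i && in_arc r i y) r (i0 := i0)); rewrite ?ei0 //.
  move=> z /andP[ez zy] mz; exists z, false => i; rewrite /long_at /=.
  case: (eqVneq i z) => [->|iz]; first by rewrite andbF; apply/negbTE.
  rewrite andbT; have := neq _ _ iz; have := uni_offP i z; have := uni_offP z i.
  have := uni_offP i y; have := uni_offP z y; have := rb i; have := rb z; move: zy.
  have [] := he i z (elimN eqP iz); have [] := he z i (nesym (elimN eqP iz)); rewrite ez.
  have := mz i; have := hy i; rewrite /in_arc; clear.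
  move: (nat_of_ord i) (nat_of_ord z) (nat_of_ord y) (r i) (r z) => i' z' y' ri rz.
  move: (uni_off i y) (uni_off z y) (uni_off i z) (uni_off z i) => oiy ozy oiz ozi.
  by case: (e i) => /= h1 h2 h3 h4 h5 h6 h7 h8 h9 h10 zy hz hi [c1 c2 c3] [_ _ c4]
    [_ _ c5] [_ _ c6] iz; lia.
(* With no long arc at all, any vertex may serve as [y]. *)
case: (pickP e) => [i0 ei0|no]; last first.
  apply: (short_case (Ordinal n0)) => [j|]; first by rewrite no.
  by exists (Ordinal n0); rewrite ?no // /in_arc uni_offii; have := rb (Ordinal n0); lia.
(* The start [z] of a shortest long arc lies in every long arc, by the condition on two long
   arcs. *)
case: (arg_minnP r ei0) => z ez mz.
have hz j : e j -> in_arc r j z.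
  have [->|jz] := eqVneq j z => ej; first by rewrite /in_arc uni_offii; have := rb z; lia.
  have := neq _ _ jz; have [_ h2 _ _] := he j z (elimN eqP jz); have := h2 ej ez.
  have := mz j ej; have := rb j; rewrite /in_arc; clear.
  by have [] := uni_offP j z; have [] := uni_offP z j; lia.
case: (pickP (fun i => ~~ e i && in_arc r i z)) => [i /andP[ei iz]|no'].
  by apply: (short_case z hz); exists i.
exists z, true => i; rewrite /long_at /= andbT.
by have := no' i; have := hz i; case: (e i) => [/(_ isT)|_] /= ->.
Qed.

End LengthFunctions.

(** * Comparison of the families *)

Section Comparison.
Variable n : nat.
Implicit Types (i j x y z : 'I_n) (P : {set {set 'I_n}}).

(** For d >= 2 the short lengths are at most n and the long ones exceed n, so each length reveals
    both its arc and its kind. *)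
Lemma long_length_inj d r r' (e e' : pred 'I_n) : 1 < d ->
    (forall i, 0 < r i <= n) -> (forall i, 0 < r' i <= n) ->
  long_length d r e =1 long_length d r' e' <-> r =1 r' /\ e =1 e'.
Proof.
move=> d1 hr hr'; split=> [h|[h h'] i]; last by rewrite /long_length h h'.
suff h' i : r i = r' i /\ e i = e' i by split=> i; case: (h' i).
have := h i; have := hr i; have := hr' i; rewrite /long_length.
have : n <= d.-1 * n by rewrite leq_pmull //; lia.
by case: (e i); case: (e' i); rewrite ?mul0n; move: (d.-1 * n) => D; lia.
Qed.

(** If [z] and [z'] share a block, the arc of [z'] contains [z] and is long on the left only.
    Otherwise so is an arc from the block of [z] that avoids [z']. *)
Lemma long_atL_neq_long_atS P z z' : noncrossing P ->
  ~ long_at (block_arc P) z true =1 long_at (block_arc P) z' false.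
Proof.
move=> hP h; have [e|] := eqVneq (pblock P z) (pblock P z'); last first.
  move=> /eqP /(exists_arc_avoiding hP)[i iz iz']; have := h i.
  by rewrite /long_at (arc_pblock hP iz) (negbTE iz').
by have := h z'; rewrite /long_at (arc_pblock hP (esym e)) eqxx andbF.
Qed.

Lemma long_atL_eq P z z' : noncrossing P ->
  long_at (block_arc P) z true =1 long_at (block_arc P) z' true <-> pblock P z = pblock P z'.
Proof.
move=> hP; rewrite (eq_pblock_arcs hP) /long_at.
by split=> h i; have := h i; rewrite /= ?andbT.
Qed.

(** * Joining two blocks *)

Section Join.
Variables (P : {set {set 'I_n}}) (z z' : 'I_n).
Hypothesis hP : noncrossing P.
Let J := pjoin P z z'.
Let B := pblock P z :|: pblock P z'.

Lemma mem_join x : (x \in B) = (pblock P z == pblock P x) || (pblock P z' == pblock P x).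
Proof. by rewrite inE !(mem_pblock_noncrossing hP). Qed.

Lemma join_union x y : pblock P x = pblock P y -> (x \in B) = (y \in B).
Proof. by move=> e; rewrite !mem_join e. Qed.

Lemma join_mem : B \in J. Proof. by rewrite !inE eqxx orbT. Qed.

Lemma pblock_mem x : pblock P x \in P.
Proof. by have [/and3P[/eqP cov _ _] _] := hP; rewrite pblock_mem // cov inE. Qed.

Lemma pblock_join_mem x : x \notin B -> pblock P x \in J.
Proof.
rewrite mem_join negb_or => /andP[h1 h2].
by rewrite !inE pblock_mem eq_sym h2 eq_sym h1.
Qed.

Lemma pjoin_partition : partition J setT.
Proof.
have [pP _] := hP; have [/eqP cov tri s0] := and3P pP.
have tBU A : A \in P -> A != pblock P z -> A != pblock P z' -> [disjoint A & B].
  move=> hA h1 h2; rewrite /B -setI_eq0 setIUr setU_eq0 !setI_eq0.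
  by rewrite !(trivIsetP tri) // pblock_mem.
apply/and3P; split.
- apply/eqP/setP => x; rewrite inE; apply/bigcupP.
  case: (boolP (x \in B)) => hx; first by exists B; rewrite ?join_mem.
  by exists (pblock P x); rewrite ?pblock_join_mem // (mem_pblock_noncrossing hP).
- apply/trivIsetP => A A'; rewrite !inE.
  case/orP=> [/and3P[a1 a2 a3]|/eqP ->]; case/orP=> [/and3P[b1 b2 b3]|/eqP ->] //.
  + by apply: (trivIsetP tri).
  + by move=> _; apply: tBU.
  + by move=> _; rewrite disjoint_sym; apply: tBU.
  by rewrite eqxx.
- rewrite !inE negb_or !negb_and s0 !orbT /= eq_sym.
  by apply/set0Pn; exists z; rewrite mem_join eqxx.
Qed.

Lemma pblock_join x : pblock J x = if x \in B then B else pblock P x.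
Proof.
have [_ tri _] := and3P pjoin_partition.
case: ifP => hx; first by apply: def_pblock hx; rewrite ?join_mem.
apply: def_pblock; rewrite ?pblock_join_mem ?hx //.
by rewrite (mem_pblock_noncrossing hP).
Qed.

Lemma pblock_join_eq x y : pblock J x = pblock J y ->
  (x \in B) = (y \in B) /\ (x \notin B -> pblock P x = pblock P y).
Proof.
have xx u : u \in pblock P u by rewrite (mem_pblock_noncrossing hP).
rewrite !pblock_join; case: ifP => hx; case: ifP => hy // e.
  by have := xx y; rewrite -e hy.
by have := xx x; rewrite e hx.
Qed.

(** By hypothesis arcs starting outside the join never separate its points. So any other block lies
    in an arc avoiding a given pair of them, and cannot cross that pair. *)
Lemma noncrossing_pjoin :
    (forall j, j \notin B -> in_arc (block_arc P) j z = in_arc (block_arc P) j z') ->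
  noncrossing J.
Proof.
move=> hz; split; first exact: pjoin_partition.
have zB : z \in B by rewrite mem_join eqxx.
have sep j u v : j \notin B -> u \in B -> v \in B ->
    in_arc (block_arc P) j u = in_arc (block_arc P) j v.
  move=> jB; have E w : w \in B -> in_arc (block_arc P) j w = in_arc (block_arc P) j z.
    by rewrite mem_join => /orP[] /eqP /(arc_pblock_eq hP j) <-; rewrite ?hz.
  by move=> /E -> /E ->.
have cross x u v : x \notin B -> u \in B -> v \in B -> exists j,
    [/\ ~~ in_arc (block_arc P) j u, ~~ in_arc (block_arc P) j v & pblock P j = pblock P x].
  move=> xB uB vB; have : pblock P x <> pblock P u.
    by move/join_union; rewrite uB (negbTE xB).
  move=> /(exists_arc_avoiding hP)[j jx ju]; exists j; split=> //.
  by rewrite (sep _ v u) // (join_union jx).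
move=> a x b y ax xb xy ab xy'.
have [aB ab'] := pblock_join_eq ab; have [xB xy''] := pblock_join_eq xy'.
case: (boolP (a \in B)) (aB) ab' => ha /esym hb ab'.
  case: (boolP (x \in B)) (xB) xy'' => hx /esym hy xy''; first by rewrite !pblock_join ha hx.
  have [j [j1 j2 j3]] := cross x a b hx ha hb.
  have := arc_pblock hP j3; have := arc_pblock hP (etrans j3 (xy'' isT)); move: j1 j2.
  rewrite /in_arc; have [] := uni_offP j a; have [] := uni_offP j b.
  by have [] := uni_offP j x; have [] := uni_offP j y; lia.
case: (boolP (x \in B)) (xB) xy'' => hx /esym hy xy''; last first.
  rewrite !pblock_join (negbTE ha) (negbTE hx).
  by have [_ nc] := hP; apply: (nc a x b y); auto.
have [j [j1 j2 j3]] := cross a x y ha hx hy.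
have := arc_pblock hP j3; have := arc_pblock hP (etrans j3 (ab' isT)); move: j1 j2.
rewrite /in_arc; have [] := uni_offP j a; have [] := uni_offP j b.
by have [] := uni_offP j x; have [] := uni_offP j y; lia.
Qed.

(** If [i] lies in the join, its arc and that of [z] or [z'] cover the circle, which puts both
    points in arc [i]. Otherwise the ends of a separating arc would cross the joined block. *)
Lemma pjoin_arc : noncrossing J -> ~~ in_arc (block_arc P) z z' ->
    ~~ in_arc (block_arc P) z' z ->
  forall i, i <> z -> i <> z' -> in_arc (block_arc P) i z = in_arc (block_arc P) i z'.
Proof.
move=> hJ h1 h2 i iz iz'.
have zB : z \in B by rewrite mem_join eqxx.
have zB' : z' \in B by rewrite mem_join eqxx orbT.
case: (boolP (i \in B)) => [|iB].
  rewrite mem_join => /orP[] /eqP e; rewrite (arc_pblock hP (esym e)).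
    by have := pblock_arcs_cover hP z' (esym e) iz; rewrite (negbTE h1) orbF => ->.
  by have := pblock_arcs_cover hP z (esym e) iz'; rewrite (negbTE h2) orbF => ->.
have lem u v : u \in B -> v \in B -> in_arc (block_arc P) i u -> in_arc (block_arc P) i v.
  move=> uB vB hu; apply/negPn/negP => hv.
  have kB : kvert P i \notin B by rewrite (join_union (pblock_kvert hP i)).
  suff : pblock J i = pblock J u by case/pblock_join_eq; rewrite uB (negbTE iB).
  have iu : (i : nat) <> u by move=> /ord_inj e; rewrite e uB in iB.
  have ku : (kvert P i : nat) <> u by move=> /ord_inj e; rewrite e uB in kB.
  apply: (noncrossing_circular hJ (b := kvert P i) (y := v)).
  - by rewrite !pblock_join (negbTE iB) (negbTE kB) pblock_kvert.
  - by rewrite !pblock_join uB vB.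
  - move: hu hv; rewrite /in_arc /block_arc; have [] := uni_offP i u.
    by have [] := uni_offP i (kvert P i); lia.
  by move: hu hv; rewrite /in_arc /block_arc; lia.
by apply/idP/idP; apply: lem.
Qed.

End Join.

Lemma long_atS_eq P z z' : noncrossing P ->
  long_at (block_arc P) z false =1 long_at (block_arc P) z' false <->
  (z = z' \/ [disjoint hat P z & hat P z']) /\ noncrossing (pjoin P z z').
Proof.
move=> hP; have [->|/eqP zz'] := eqVneq z z'.
  by split=> // _; split; [left | apply: noncrossing_pjoin].
have zz i : in_arc (block_arc P) i i by apply: arc_pblock.
split=> [h|[[//|hd] hJ] i].
  (* At [z] the left side is false, and [z] differs from [z'], so arc [z] misses [z']; the same
     argument applies at [z']. *)
  have h1 : ~~ in_arc (block_arc P) z z'.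
    by have := h z; rewrite /long_at eqxx andbF /= (introN eqP zz') andbT => <-.
  have h2 : ~~ in_arc (block_arc P) z' z.
    have := h z'; rewrite /long_at eqxx andbF /= eq_sym (introN eqP zz') andbT => ->.
    by [].
  split.
    right; apply/pred0P => x /=; rewrite !(mem_hat hP); apply/negP => /andP[].
    move: h1 h2; rewrite /in_arc; have [] := uni_offP z z'; have [] := uni_offP z' z.
    by have [] := uni_offP z x; have [] := uni_offP z' x; lia.
  apply: noncrossing_pjoin => // j; rewrite (mem_join _ _ hP) negb_or => /andP[jz jz'].
  have := h j; rewrite /long_at /=.
  have -> : j != z by apply: contraNneq jz => ->.
  have -> : j != z' by apply: contraNneq jz' => ->.
  by rewrite !andbT.
have h1 : ~~ in_arc (block_arc P) z z'.
  by have := disjointFl hd (x := z'); rewrite !(mem_hat hP) => ->.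
have h2 : ~~ in_arc (block_arc P) z' z.
  by have := disjointFr hd (x := z); rewrite !(mem_hat hP) => ->.
rewrite /long_at /=; have [->|/eqP iz] := eqVneq i z; first by rewrite andbF (negbTE h1).
have [->|/eqP iz'] := eqVneq i z'; first by rewrite andbF (negbTE h2).
by rewrite !andbT; apply: pjoin_arc.
Qed.

Lemma uni_len_lL d P z i : noncrossing P ->
  uni_len i (kvert P i) (lL d P z i) =
  long_length d (block_arc P) (long_at (block_arc P) z true) i.
Proof.
move=> hP; rewrite /uni_len -/(uni_off _ _) addn1 /lL (disjoint_hat_pblock hP).
by rewrite /long_length /long_at andbT if_neg.
Qed.

Lemma uni_len_lS d P z i : noncrossing P ->
  uni_len i (kvert P i) (lS d P z i) =
  long_length d (block_arc P) (long_at (block_arc P) z false) i.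
Proof.
move=> hP; rewrite /uni_len -/(uni_off _ _) addn1 /lS (disjoint_hat_pblock hP).
by rewrite /long_length /long_at; case: (in_arc _ _ _) => //=; case: (i == z).
Qed.

(** * The families described by length functions *)

Section Families.
Variables (k : fieldType) (d : nat).

Definition partition_family P z b :=
  @uniserial_family k n (long_length d (block_arc P) (long_at (block_arc P) z b)).

Lemma famLE P z X : noncrossing P -> famL k d P z X <-> partition_family P z true X.
Proof.
move=> hP; have e i := uni_len_lL d z i hP.
by split=> -[i]; rewrite ?Mod_uniserial => h; exists i; [rewrite -e | rewrite Mod_uniserial e].
Qed.

Lemma famSE P z X : noncrossing P -> famS k d P z X <-> partition_family P z false X.
Proof.
move=> hP; have e i := uni_len_lS d z i hP.
by split=> -[i]; rewrite ?Mod_uniserial => h; exists i; [rewrite -e | rewrite Mod_uniserial e].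
Qed.

Lemma is_sms_ext l (S S' : rep k n -> Prop) : (forall X, S X <-> S' X) ->
  is_sms l S -> is_sms l S'.
Proof.
move=> e [h1 h2 h3 h4 h5]; split.
- by move=> X Y XY /e SX; apply/e; apply: h1 XY SX.
- by move=> X /e; apply: h2.
- by move=> X Y /e hX /e; apply: h3.
- by move=> X /e; apply: h4.
by move=> X hX pX; have [Y [/e SY hY]] := h5 X hX pX; exists Y.
Qed.

Lemma family_eq P P' z z' b b' : 1 < d -> noncrossing P -> noncrossing P' ->
  (forall X, partition_family P z b X <-> partition_family P' z' b' X) <->
  P = P' /\ long_at (block_arc P) z b =1 long_at (block_arc P) z' b'.
Proof.
move=> d1 hP hP'; have [rb _] := block_arc_noncrossing hP.
have [rb' _] := block_arc_noncrossing hP'.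
rewrite uniserial_family_inj.
- rewrite long_length_inj //; split=> [[e h]|[<- h]] //.
  by have eP := noncrossing_arc_inj hP hP' e; split=> //; move: h; rewrite -eP.
- by move=> i; rewrite /long_length; have := rb i; lia.
by move=> i; rewrite /long_length; have := rb' i; lia.
Qed.

End Families.
End Comparison.

(** * Simple-minded systems classified by non-crossing partitions *)

Theorem theorem4p10 (k : closedFieldType) (n d : nat) (hn : (0 < n)%N) (hd : (0 < d)%N) :
  (* (a) *)
  (forall (P : {set {set 'I_n}}) (kk : 'I_n), noncrossing P ->
     is_sms (d * n) (famL k d P kk) /\ is_sms (d * n) (famS k d P kk)) /\
  (* (b) *)
  (forall S : rep k n -> Prop, is_sms (d * n) S ->
     exists (P : {set {set 'I_n}}) (kk : 'I_n), noncrossing P /\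
       ((forall X, S X <-> famL k d P kk X) \/ (forall X, S X <-> famS k d P kk X))) /\
  (* (c) *)
  ((1 < d)%N ->
   forall (P P' : {set {set 'I_n}}) (kk kk' : 'I_n), noncrossing P -> noncrossing P' ->
     [/\ ~ (forall X, famL k d P kk X <-> famS k d P' kk' X),
         ((forall X, famL k d P kk X <-> famL k d P' kk' X) <->
            (P = P' /\ pblock P kk = pblock P kk'))
       & ((forall X, famS k d P kk X <-> famS k d P' kk' X) <->
            [/\ P = P', kk = kk' \/ [disjoint hat P kk & hat P kk']
              & noncrossing (pjoin P kk kk')])]).
Proof.
have sms P z b : noncrossing P -> is_sms (d * n) (@partition_family n k d P z b).
  by move=> /block_arc_noncrossing hP; apply: sms_lengths_sms; apply: sms_lengths_long_length.
split; [|split].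
- move=> P z hP; split; [apply: (is_sms_ext _ (sms P z true hP)) |
    apply: (is_sms_ext _ (sms P z false hP))] => X; symmetry; [exact: famLE | exact: famSE].
- move=> S /sms_has_lengths[|lam [/(sms_lengths_long_at hd hn)[P [z [b [hP el]]]] hS]].
    by rewrite muln_gt0 hd hn.
  have {}hS X : S X <-> @partition_family n k d P z b X.
    rewrite hS; split=> -[i]; first by rewrite el => h; exists i.
    by move=> h; exists i; rewrite el.
  by exists P, z; split=> //; case: b {el} hS => hS; [left | right] => X; rewrite hS;
    symmetry; [exact: famLE | exact: famSE].
move=> d1 P P' z z' hP hP'; split.
- move=> h; have /(family_eq _ _ _ _ _ d1 hP hP')[_] :
    forall X, @partition_family n k d P z true X <-> @partition_family n k d P' z' false X.
    by move=> X; rewrite -famLE // -famSE.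
  exact: long_atL_neq_long_atS.
- rewrite -(long_atL_eq z z' hP) -(family_eq k z z' true true d1 hP hP').
  by split=> h X; have := h X; rewrite !famLE.
have -> : [/\ P = P', z = z' \/ [disjoint hat P z & hat P z'] & noncrossing (pjoin P z z')]
    <-> P = P' /\ long_at (block_arc P) z false =1 long_at (block_arc P) z' false.
  by rewrite long_atS_eq //; split=> [[]|[? []]].
rewrite -(family_eq k z z' false false d1 hP hP').
by split=> h X; have := h X; rewrite !famSE.
Qed.
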